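(* The following is provable in $\mathsf{RCA}_0$: every infinite effectively Hausdorff CSC space which is not discrete has an infinite effectively discrete subspace.
   Context: A countable second-countable (CSC) space (formalized in second-order arithmetic) is a tuple $\langle X,\mathcal{U},k\rangle$ where $X\subseteq\mathbb{N}$; $\mathcal{U}=\langle U_n:n\in\mathbb{N}\rangle$ is a sequence of subsets of $X$ such that every $x\in X$ belongs to some $U_n$; and $k:X\times\mathbb{N}\times\mathbb{N}\to\mathbb{N}$ is such that whenever $x\in U_m\cap U_n$ we have $x\in U_{k(x,m,n)}\subseteq U_m\cap U_n$. Write $U\in\mathcal{U}$ if $U=U_n$ for some $n$. It is infinite if $X$ is infinite; discrete if $\{x\}\in\mathcal{U}$ for every $x\in X$. It is effectively Hausdorff if there is a function $e:X\times X\to\mathbb{N}$ such that for all distinct $x,y\in X$, $e(x,y)=\langle m,n\rangle$ with $x\in U_m$, $y\in U_n$ and $U_m\cap U_n=\emptyset$. For $Y\subseteq X$ the subspace $Y$ is $\langle Y,\langle U_n\cap Y:n\in\mathbb{N}\rangle,k\rangle$; it is effectively discrete if there is a function $d:Y\to\mathbb{N}$ with $U_{d(x)}\cap Y=\{x\}$ for all $x\in Y$. *)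

(* Defs.v *)
From Stdlib Require Import List.

(** * The language L2 of second-order arithmetic

    Two sorts of de Bruijn variables, numbered independently: number variables
    [$ n] and set variables, written as a bare [nat] since they are the only
    terms of the set sort.  A number quantifier binds the number variable 0, a
    set quantifier binds the set variable 0.  As usual for L2, equality is
    primitive on numbers only. *)

Inductive term : Type :=
| tvar (n : nat)
| tzero
| tone
| tadd (s t : term)
| tmul (s t : term).

Inductive form : Type :=
| feq (s t : term)
| flt (s t : term)
| fmem (t : term) (X : nat)
| fbot
| fimp (p q : form)
| fand (p q : form)
| for_ (p q : form)
| fall (p : form)
| fex (p : form)
| fall2 (p : form)
| fex2 (p : form).

Definition fneg (p : form) : form := fimp p fbot.
Definition fiff (p q : form) : form := fand (fimp p q) (fimp q p).

Declare Scope l2t_scope.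
Declare Scope l2_scope.
Delimit Scope l2t_scope with l2t.
Delimit Scope l2_scope with l2.
Bind Scope l2t_scope with term.
Bind Scope l2_scope with form.

Notation "$ n" := (tvar n) (at level 1, n at level 0, format "$ n") : l2t_scope.
Notation "0" := tzero : l2t_scope.
Notation "1" := tone : l2t_scope.
Infix "+" := tadd : l2t_scope.
Infix "*" := tmul : l2t_scope.

Notation "s ≡ t" := (feq s%l2t t%l2t) (at level 70) : l2_scope.
Notation "s ≺ t" := (flt s%l2t t%l2t) (at level 70) : l2_scope.
Notation "t ∈ X" := (fmem t%l2t X%nat) (at level 70) : l2_scope.
Notation "⊥" := fbot (at level 0) : l2_scope.
Notation "¬ p" := (fneg p) (at level 75, right associativity) : l2_scope.
Notation "p ∧ q" := (fand p q) (at level 80, right associativity) : l2_scope.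
Notation "p ∨ q" := (for_ p q) (at level 85, right associativity) : l2_scope.
Notation "p ⇒ q" := (fimp p q) (at level 90, right associativity) : l2_scope.
Notation "p ⇔ q" := (fiff p q) (at level 95, no associativity) : l2_scope.
Notation "∀ p" := (fall p) (at level 97, right associativity) : l2_scope.
Notation "∃ p" := (fex p) (at level 97, right associativity) : l2_scope.
Notation "∀₂ p" := (fall2 p) (at level 97, right associativity) : l2_scope.
Notation "∃₂ p" := (fex2 p) (at level 97, right associativity) : l2_scope.

Local Open Scope l2_scope.

(** ** Capture-avoiding simultaneous substitution

    Number variables are replaced by terms, set variables by set variables. *)

Fixpoint tsubst (sg : nat -> term) (t : term) : term :=
  match t with
  | tvar n => sg n
  | tzero => tzero
  | tone => tone
  | tadd s u => tadd (tsubst sg s) (tsubst sg u)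
  | tmul s u => tmul (tsubst sg s) (tsubst sg u)
  end.

Definition tshift : term -> term := tsubst (fun n => tvar (S n)).

Definition up (sg : nat -> term) (n : nat) : term :=
  match n with 0 => tvar 0 | S m => tshift (sg m) end.

Definition up2 (rho : nat -> nat) (n : nat) : nat :=
  match n with 0 => 0 | S m => S (rho m) end.

Fixpoint fsubst (sg : nat -> term) (rho : nat -> nat) (p : form) : form :=
  match p with
  | feq s t => feq (tsubst sg s) (tsubst sg t)
  | flt s t => flt (tsubst sg s) (tsubst sg t)
  | fmem t X => fmem (tsubst sg t) (rho X)
  | fbot => fbot
  | fimp p q => fimp (fsubst sg rho p) (fsubst sg rho q)
  | fand p q => fand (fsubst sg rho p) (fsubst sg rho q)
  | for_ p q => for_ (fsubst sg rho p) (fsubst sg rho q)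
  | fall p => fall (fsubst (up sg) rho p)
  | fex p => fex (fsubst (up sg) rho p)
  | fall2 p => fall2 (fsubst sg (up2 rho) p)
  | fex2 p => fex2 (fsubst sg (up2 rho) p)
  end.

Definition fshift : form -> form := fsubst (fun n => tvar (S n)) (fun X => X).
Definition fshift2 : form -> form := fsubst tvar S.

Definition inst (t : term) (p : form) : form :=
  fsubst (fun n => match n with 0 => t | S m => tvar m end) (fun X => X) p.

Definition inst2 (Y : nat) (p : form) : form :=
  fsubst tvar (fun X => match X with 0 => Y | S m => m end) p.

(** [p(n + 1)] in place of [p(n)], where [n] is (and remains) the number
    variable 0. *)
Definition fsucc (p : form) : form :=
  fsubst (fun n => match n with 0 => tadd (tvar 0) tone | S m => tvar (S m) end)
         (fun X => X) p.

(** * Provability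

    Classical natural deduction for two-sorted logic with equality on the
    number sort.  A free variable in an axiom of [T] is understood as
    universally quantified: [prv_ax] is available under every context, and in
    particular [prv_allI], [prv_all2I] generalise axioms without restriction. *)

Inductive prv (T : form -> Prop) : list form -> form -> Prop :=
| prv_ax G p : T p -> prv T G p
| prv_hyp G p : In p G -> prv T G p
| prv_impI G p q : prv T (p :: G) q -> prv T G (p ⇒ q)
| prv_impE G p q : prv T G (p ⇒ q) -> prv T G p -> prv T G q
| prv_raa G p : prv T ((¬ p) :: G) ⊥ -> prv T G p
| prv_andI G p q : prv T G p -> prv T G q -> prv T G (p ∧ q)
| prv_andE1 G p q : prv T G (p ∧ q) -> prv T G p
| prv_andE2 G p q : prv T G (p ∧ q) -> prv T G q
| prv_orI1 G p q : prv T G p -> prv T G (p ∨ q)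
| prv_orI2 G p q : prv T G q -> prv T G (p ∨ q)
| prv_orE G p q r :
    prv T G (p ∨ q) -> prv T (p :: G) r -> prv T (q :: G) r -> prv T G r
| prv_allI G p : prv T (map fshift G) p -> prv T G (∀ p)
| prv_allE G p t : prv T G (∀ p) -> prv T G (inst t p)
| prv_exI G p t : prv T G (inst t p) -> prv T G (∃ p)
| prv_exE G p q :
    prv T G (∃ p) -> prv T (p :: map fshift G) (fshift q) -> prv T G q
| prv_all2I G p : prv T (map fshift2 G) p -> prv T G (∀₂ p)
| prv_all2E G p Y : prv T G (∀₂ p) -> prv T G (inst2 Y p)
| prv_ex2I G p Y : prv T G (inst2 Y p) -> prv T G (∃₂ p)
| prv_ex2E G p q :
    prv T G (∃₂ p) -> prv T (p :: map fshift2 G) (fshift2 q) -> prv T G q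
| prv_eqI G t : prv T G (t ≡ t)
| prv_eqE G p s t : prv T G (s ≡ t) -> prv T G (inst s p) -> prv T G (inst t p).

Definition provable (T : form -> Prop) (p : form) : Prop := prv T nil p.

(** * The theory RCA_0 *)

(** Bounded-quantifier formulas; the bound [t] is a term in which the
    quantified variable does not occur, whence the shift. *)
Inductive Delta00 : form -> Prop :=
| D0_eq s t : Delta00 (s ≡ t)
| D0_lt s t : Delta00 (s ≺ t)
| D0_mem t X : Delta00 (t ∈ X)
| D0_bot : Delta00 ⊥
| D0_imp p q : Delta00 p -> Delta00 q -> Delta00 (p ⇒ q)
| D0_and p q : Delta00 p -> Delta00 q -> Delta00 (p ∧ q)
| D0_or p q : Delta00 p -> Delta00 q -> Delta00 (p ∨ q)
| D0_ball t p : Delta00 p -> Delta00 (∀ $0 ≺ tshift t ⇒ p)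
| D0_bex t p : Delta00 p -> Delta00 (∃ $0 ≺ tshift t ∧ p).

Inductive Sigma01 : form -> Prop :=
| Sigma01_ex p : Delta00 p -> Sigma01 (∃ p).

Inductive Pi01 : form -> Prop :=
| Pi01_all p : Delta00 p -> Pi01 (∀ p).

Inductive RCA0 : form -> Prop :=
| ax_succ_neq0 : RCA0 (∀ ¬ ($0 + 1 ≡ 0))
| ax_succ_inj : RCA0 (∀ ∀ $1 + 1 ≡ $0 + 1 ⇒ $1 ≡ $0)
| ax_add0 : RCA0 (∀ $0 + 0 ≡ $0)
| ax_addS : RCA0 (∀ ∀ $1 + ($0 + 1) ≡ ($1 + $0) + 1)
| ax_mul0 : RCA0 (∀ $0 * 0 ≡ 0)
| ax_mulS : RCA0 (∀ ∀ $1 * ($0 + 1) ≡ $1 * $0 + $1)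
| ax_lt0 : RCA0 (∀ ¬ ($0 ≺ 0))
| ax_ltS : RCA0 (∀ ∀ $1 ≺ $0 + 1 ⇔ $1 ≺ $0 ∨ $1 ≡ $0)
| ax_Sigma01_induction p :
    Sigma01 p -> RCA0 (inst 0 p ∧ (∀ p ⇒ fsucc p) ⇒ (∀ p))
| ax_Delta01_comprehension p q :
    Sigma01 p -> Pi01 q -> RCA0 ((∀ p ⇔ q) ⇒ (∃₂ ∀ $0 ∈ 0 ⇔ fshift2 p)).

(** * Topology inside second-order arithmetic

    Parameters of type [nat] ([X], [U], [K], ...) are set variables of the
    context in which the formula is placed; they become [S X], [S U], ... below
    a set quantifier. *)

(** The pairing term (s + t)^2 + s, which RCA_0 proves injective. *)
Definition tpair (s t : term) : term := ((s + t) * (s + t) + s)%l2t.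

Notation "⟨ s , t ⟩" := (tpair s t) (at level 0, s at level 60, t at level 60) :
  l2t_scope.

(** A sequence of sets is coded by the single set [U], with
    U_n = { x | ⟨x,n⟩ ∈ U }. *)
Definition in_seq (x : term) (U : nat) (n : term) : form := ⟨x, n⟩ ∈ U.

Notation "x ∈[ U , n ]" := (in_seq x%l2t U%nat n%l2t)
  (at level 70, U at level 60, n at level 60) : l2_scope.

(** Membership of (the code) [t] in X, X × X and X × N × N, where a triple is
    coded as ⟨⟨x,m⟩,n⟩. *)
Definition dom1 (X : nat) (t : term) : form := t ∈ X.
Definition domXX (X : nat) (t : term) : form :=
  ∃ ∃ $1 ∈ X ∧ $0 ∈ X ∧ tshift (tshift t) ≡ ⟨$1, $0⟩.
Definition domXNN (X : nat) (t : term) : form :=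
  ∃ ∃ ∃ $2 ∈ X ∧ tshift (tshift (tshift t)) ≡ ⟨⟨$2, $1⟩, $0⟩.

(** [F] is (the graph of) a function from the class [D] to N. *)
Definition is_fun (D : term -> form) (F : nat) : form :=
    (∀ $0 ∈ F ⇒ (∃ ∃ D ($1)%l2t ∧ $2 ≡ ⟨$1, $0⟩))
  ∧ (∀ D ($0)%l2t ⇒ (∃ ⟨$1, $0⟩ ∈ F))
  ∧ (∀ ∀ ∀ ⟨$2, $1⟩ ∈ F ⇒ ⟨$2, $0⟩ ∈ F ⇒ $1 ≡ $0).

(** F(a) = b *)
Definition maps (F : nat) (a b : term) : form := ⟨a, b⟩ ∈ F.

Definition subset (Y X : nat) : form := ∀ $0 ∈ Y ⇒ $0 ∈ X.

(** A set is finite if it has an upper bound. *)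
Definition infinite (X : nat) : form := ¬ (∃ ∀ $0 ∈ X ⇒ $0 ≺ $1).

Definition csc_space (X U K : nat) : form :=
    (∀ ∀ $0 ∈[U, $1] ⇒ $0 ∈ X)
  ∧ (∀ $0 ∈ X ⇒ (∃ $1 ∈[U, $0]))
  ∧ is_fun (domXNN X) K
  ∧ (* x = $3, m = $2, n = $1, k(x,m,n) = $0 *)
    (∀ ∀ ∀ ∀ $3 ∈[U, $2] ∧ $3 ∈[U, $1] ∧ maps K ⟨⟨$3, $2⟩, $1⟩ $0 ⇒
       $3 ∈[U, $0]
       ∧ (∀ $0 ∈[U, $1] ⇒ $0 ∈[U, $3] ∧ $0 ∈[U, $2])).

Definition discrete (X U : nat) : form :=
  ∀ $0 ∈ X ⇒ (∃ ∀ $0 ∈[U, $1] ⇔ $0 ≡ $2).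

(** Under the set quantifier, the function e is the set variable 0. *)
Definition effectively_Hausdorff (X U : nat) : form :=
  ∃₂ is_fun (domXX (S X)) 0
   ∧ (∀ ∀ $1 ∈ S X ∧ $0 ∈ S X ∧ ¬ ($1 ≡ $0) ⇒
       (* x = $3, y = $2, m = $1, n = $0 *)
       (∃ ∃ maps 0 ⟨$3, $2⟩ ⟨$1, $0⟩
          ∧ $3 ∈[S U, $1] ∧ $2 ∈[S U, $0]
          ∧ (∀ ¬ ($0 ∈[S U, $2] ∧ $0 ∈[S U, $1])))).

(** The subspace [Y] of a space with basis [U]: its n-th basic open set is
    U_n ∩ Y.  Under the set quantifier, the function d is the set variable 0. *)
Definition effectively_discrete_subspace (Y U : nat) : form :=
  ∃₂ is_fun (dom1 (S Y)) 0
   ∧ (∀ ∀ $1 ∈ S Y ∧ maps 0 $1 $0 ⇒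
       (∀ $0 ∈[S U, $1] ∧ $0 ∈ S Y ⇔ $0 ≡ $2)).

(* Main.v *)
(** By the completeness theorem it suffices to argue in an arbitrary model of
    RCA_0, with equality interpreted as identity.  A model of RCA_0 admits
    primitive recursion, because finite sets are coded by numbers: p belongs to
    the set coded by (k, m, n) if p < k and m (p + 1) + 1 divides n.

    Let x be a point with {x} not basic open, let e be the Hausdorff function and
    write e(x,z) = <e1(x,z), e2(x,z)>.  Starting from a basic neighbourhood of x,
    define indices u(z) of neighbourhoods of x by
    u(z+1) = k(x, u(z), e1(x,z)) if z <> x lies in U_u(z), and u(z+1) = u(z)
    otherwise.  These neighbourhoods decrease.  The set Y of all z <> x lying in
    U_u(z) is unbounded: if it were bounded by b, then u would be constant from b
    on; but U_u(b) has a point y <> x, which is at least b, as every smaller point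
    has been left out by then, so y belongs to Y.  Each y in Y is isolated in Y
    by k(y, u(y), e2(x,y)): later points of Y lie in U_e1(x,y), and y lies
    in U_e1(x,z) for each earlier z in Y. *)

From Stdlib Require Import List Arith Lia Cantor Ring.
From Stdlib Require Import Classical ClassicalEpsilon FunctionalExtensionality
  PropExtensionality ProofIrrelevance.
Require Import Defs.
Import ListNotations.

Local Open Scope l2_scope.

(** * Substitution calculus for the two-sorted syntax *)

Definition scons {A : Type} (a : A) (f : nat -> A) (n : nat) : A :=
  match n with 0 => a | S m => f m end.

Ltac ext_nat := let n := fresh "n" in extensionality n; destruct n; try reflexivity.

Lemma tsubst_id t : tsubst tvar t = t.
Proof. induction t; cbn; congruence. Qed.

Lemma up_id : up tvar = tvar.
Proof. ext_nat. Qed.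

Lemma up2_id : up2 (fun X => X) = fun X => X.
Proof. ext_nat. Qed.

Lemma fsubst_id p : fsubst tvar (fun X => X) p = p.
Proof. induction p; cbn; rewrite ?tsubst_id, ?up_id, ?up2_id; congruence. Qed.

Lemma tsubst_comp sg ta t :
  tsubst sg (tsubst ta t) = tsubst (fun n => tsubst sg (ta n)) t.
Proof. induction t; cbn; congruence. Qed.

Lemma up_comp sg ta :
  (fun n => tsubst (up sg) (up ta n)) = up (fun n => tsubst sg (ta n)).
Proof.
  ext_nat. cbn. unfold tshift. rewrite !tsubst_comp. reflexivity.
Qed.

Lemma up2_comp r s : (fun X => up2 r (up2 s X)) = up2 (fun X => r (s X)).
Proof. ext_nat. Qed.

Lemma fsubst_comp p : forall sg r ta s,
  fsubst sg r (fsubst ta s p) =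
  fsubst (fun n => tsubst sg (ta n)) (fun X => r (s X)) p.
Proof.
  induction p; intros; cbn; rewrite ?tsubst_comp; f_equal; auto.
  - rewrite IHp, up_comp; reflexivity.
  - rewrite IHp, up_comp; reflexivity.
  - rewrite IHp, up2_comp; reflexivity.
  - rewrite IHp, up2_comp; reflexivity.
Qed.

Ltac subst_eq :=
  unfold inst, inst2, fshift, fshift2, fsucc; rewrite ?fsubst_comp;
  f_equal; ext_nat; cbn; unfold tshift; rewrite ?tsubst_comp; cbn;
  rewrite ?tsubst_id; try reflexivity.

Lemma fsubst_inst sg r t p :
  fsubst sg r (inst t p) = inst (tsubst sg t) (fsubst (up sg) r p).
Proof. subst_eq. Qed.

Lemma fsubst_inst2 sg r Y p :
  fsubst sg r (inst2 Y p) = inst2 (r Y) (fsubst sg (up2 r) p).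
Proof.
  unfold inst2. rewrite !fsubst_comp. f_equal.
  - extensionality n. cbn. symmetry. apply tsubst_id.
  - ext_nat.
Qed.

Lemma fsubst_fshift sg r p :
  fsubst (up sg) r (fshift p) = fshift (fsubst sg r p).
Proof. subst_eq. Qed.

Lemma fsubst_fshift2 sg r p :
  fsubst sg (up2 r) (fshift2 p) = fshift2 (fsubst sg r p).
Proof.
  unfold fshift2. rewrite !fsubst_comp. f_equal.
  extensionality n. cbn. symmetry. apply tsubst_id.
Qed.

Lemma fsubst_fsucc sg r p :
  fsubst (up sg) r (fsucc p) = fsucc (fsubst (up sg) r p).
Proof. subst_eq. Qed.

Lemma tsubst_tshift sg t : tsubst (up sg) (tshift t) = tshift (tsubst sg t).
Proof. unfold tshift. rewrite !tsubst_comp. reflexivity. Qed.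

Lemma map_fshift_subst sg r G :
  map (fsubst (up sg) r) (map fshift G) = map fshift (map (fsubst sg r) G).
Proof. rewrite !map_map. apply map_ext. apply fsubst_fshift. Qed.

Lemma map_fshift2_subst sg r G :
  map (fsubst sg (up2 r)) (map fshift2 G) = map fshift2 (map (fsubst sg r) G).
Proof. rewrite !map_map. apply map_ext. apply fsubst_fshift2. Qed.

Lemma Delta00_subst p : Delta00 p -> forall sg r, Delta00 (fsubst sg r p).
Proof.
  induction 1; intros; cbn; try (constructor; auto; fail).
  - rewrite tsubst_tshift. apply D0_ball. auto.
  - rewrite tsubst_tshift. apply D0_bex. auto.
Qed.

(** The axiom schemes contain parameters, so the set of axioms must be closed under renaming these;
    this is what allows substitution into whole derivations. *)
Lemma RCA0_subst p : RCA0 p -> forall sg r, RCA0 (fsubst sg r p).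
Proof.
  destruct 1; intros; try (cbn; constructor; fail).
  - cbn. rewrite fsubst_inst, fsubst_fsucc. cbn. apply ax_Sigma01_induction.
    destruct H. cbn. constructor. apply Delta00_subst, H.
  - cbn. rewrite fsubst_fshift2. apply ax_Delta01_comprehension.
    + destruct H. cbn. constructor. apply Delta00_subst, H.
    + destruct H0. cbn. constructor. apply Delta00_subst, H0.
Qed.

(** * Completeness *)

(* A single bound for the variables of both sorts; binders do not lower it. *)
Fixpoint tbound (t : term) : nat :=
  match t with
  | tvar n => S n
  | tzero | tone => 0
  | tadd s u | tmul s u => max (tbound s) (tbound u)
  end.

Fixpoint fbound (p : form) : nat :=
  match p with
  | feq s t | flt s t => max (tbound s) (tbound t)
  | fmem t X => max (tbound t) (S X)
  | fbot => 0
  | fimp p q | fand p q | for_ p q => max (fbound p) (fbound q)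
  | fall p | fex p | fall2 p | fex2 p => fbound p
  end.

Lemma tsubst_ext sg ta t :
  (forall n, n < tbound t -> sg n = ta n) -> tsubst sg t = tsubst ta t.
Proof.
  induction t; cbn; intros H; auto; f_equal;
    (apply IHt1 || apply IHt2); intros; apply H; lia.
Qed.

(** The coarse bound suffices: under a binder the variable [S n] refers to [n] outside, and [n] is
    again below the undiminished bound. *)
Lemma fsubst_ext p : forall sg ta r s,
  (forall n, n < fbound p -> sg n = ta n) ->
  (forall n, n < fbound p -> r n = s n) -> fsubst sg r p = fsubst ta s p.
Proof.
  induction p; cbn; intros sg ta r s' H H'; auto; f_equal;
    try (apply tsubst_ext; intros; apply H; lia);
    try (apply H'; lia);
    try (apply IHp1 || apply IHp2); try apply IHp;
    try (intros; first [apply H | apply H']; lia);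
    intros [|n] Hn; cbn; auto; f_equal; (apply H || apply H'); lia.
Qed.

(** * Enumeration of all formulas *)

Fixpoint tcode (t : term) : nat :=
  match t with
  | tvar n => to_nat (0, n)
  | tzero => to_nat (1, 0)
  | tone => to_nat (2, 0)
  | tadd s u => to_nat (3, to_nat (tcode s, tcode u))
  | tmul s u => to_nat (4, to_nat (tcode s, tcode u))
  end.

Fixpoint fcode (p : form) : nat :=
  match p with
  | feq s t => to_nat (0, to_nat (tcode s, tcode t))
  | flt s t => to_nat (1, to_nat (tcode s, tcode t))
  | fmem t X => to_nat (2, to_nat (tcode t, X))
  | fbot => to_nat (3, 0)
  | fimp p q => to_nat (4, to_nat (fcode p, fcode q))
  | fand p q => to_nat (5, to_nat (fcode p, fcode q))
  | for_ p q => to_nat (6, to_nat (fcode p, fcode q))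
  | fall p => to_nat (7, fcode p)
  | fex p => to_nat (8, fcode p)
  | fall2 p => to_nat (9, fcode p)
  | fex2 p => to_nat (10, fcode p)
  end.

Lemma pair_code_inj a b c d : to_nat (a, b) = to_nat (c, d) -> a = c /\ b = d.
Proof. intros H. apply to_nat_inj in H. injection H. auto. Qed.

Ltac code_inj :=
  repeat match goal with
  | H : to_nat _ = to_nat _ |- _ => apply pair_code_inj in H; destruct H
  end; try discriminate; subst; auto.

Lemma tcode_inj s : forall t, tcode s = tcode t -> s = t.
Proof.
  induction s; destruct t; cbn -[to_nat]; intros; code_inj; f_equal; auto.
Qed.

Lemma fcode_inj p : forall q, fcode p = fcode q -> p = q.
Proof.
  induction p; destruct q; cbn -[to_nat]; intros; code_inj; f_equal; auto using tcode_inj.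
Qed.

(** A number that codes no formula yields an arbitrary one; it only matters that every formula
    occurs somewhere in the enumeration. *)
Definition nth_form (n : nat) : form :=
  epsilon (inhabits ⊥) (fun p => fcode p = n).

Lemma nth_form_fcode p : nth_form (fcode p) = p.
Proof.
  apply fcode_inj. unfold nth_form.
  apply (epsilon_spec (inhabits ⊥) (fun q => fcode q = fcode p)). eauto.
Qed.

(** * Structures and satisfaction *)

Record structure : Type := {
  dom : Type;
  sets : Type;
  zero : dom;
  one : dom;
  add : dom -> dom -> dom;
  mul : dom -> dom -> dom;
  less : dom -> dom -> Prop;
  elem : dom -> sets -> Prop }.

Fixpoint teval (M : structure) (v : nat -> dom M) (t : term) : dom M :=
  match t with
  | tvar n => v n
  | tzero => zero M
  | tone => one M
  | tadd s u => add M (teval M v s) (teval M v u)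
  | tmul s u => mul M (teval M v s) (teval M v u)
  end.

Fixpoint sat (M : structure) (v : nat -> dom M) (r : nat -> sets M) (p : form)
  : Prop :=
  match p with
  | feq s t => teval M v s = teval M v t
  | flt s t => less M (teval M v s) (teval M v t)
  | fmem t X => elem M (teval M v t) (r X)
  | fbot => False
  | fimp p q => sat M v r p -> sat M v r q
  | fand p q => sat M v r p /\ sat M v r q
  | for_ p q => sat M v r p \/ sat M v r q
  | fall p => forall d, sat M (scons d v) r p
  | fex p => exists d, sat M (scons d v) r p
  | fall2 p => forall A, sat M v (scons A r) p
  | fex2 p => exists A, sat M v (scons A r) p
  end.

Definition model (T : form -> Prop) (M : structure) : Prop :=
  forall p, T p -> forall v r, sat M v r p.

Lemma teval_subst M v sg t :
  teval M v (tsubst sg t) = teval M (fun n => teval M v (sg n)) t.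
Proof. induction t; cbn; congruence. Qed.

Lemma scons_up M d v sg :
  (fun n => teval M (scons d v) (up sg n)) =
  scons d (fun n => teval M v (sg n)).
Proof. ext_nat. cbn. unfold tshift. rewrite teval_subst. reflexivity. Qed.

Lemma scons_up2 {A} (d : A) r s :
  (fun X => scons d r (up2 s X)) = scons d (fun X => r (s X)).
Proof. ext_nat. Qed.

Lemma sat_subst M p : forall v r sg s,
  sat M v r (fsubst sg s p) <->
  sat M (fun n => teval M v (sg n)) (fun X => r (s X)) p.
Proof.
  induction p; intros; cbn; rewrite ?teval_subst; try tauto;
    try (rewrite IHp1, IHp2; tauto).
  1,2: setoid_rewrite IHp; setoid_rewrite scons_up; tauto.
  1,2: setoid_rewrite IHp; setoid_rewrite scons_up2; tauto.
Qed.

(** * Henkin's construction over a substitution-closed theory *)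

Section Completeness.
Variable T : form -> Prop.
Hypothesis T_subst : forall p, T p -> forall sg r, T (fsubst sg r p).

(** Substitution and weakening go through in one induction on derivations: the arbitrary superset
    [G'] is carried along, and shifted together with [G] at the quantifier rules. *)
Lemma prv_subst_weak G p : prv T G p -> forall sg r G',
  incl (map (fsubst sg r) G) G' -> prv T G' (fsubst sg r p).
Proof.
  induction 1; intros sg r' G' HG; cbn in *.
  - apply prv_ax. auto.
  - apply prv_hyp, HG, in_map, H.
  - apply prv_impI, IHprv. cbn. apply incl_cons; [left; auto|apply incl_tl, HG].
  - eapply prv_impE; eauto.
  - apply prv_raa, (IHprv sg r'). cbn. apply incl_cons; [left; auto|apply incl_tl, HG].
  - apply prv_andI; auto.
  - eapply prv_andE1, IHprv, HG.
  - eapply prv_andE2, IHprv, HG.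
  - apply prv_orI1; auto.
  - apply prv_orI2; auto.
  - eapply prv_orE; [apply (IHprv1 sg r'), HG|apply IHprv2|apply IHprv3]; cbn;
      (apply incl_cons; [left; auto|apply incl_tl, HG]).
  - apply prv_allI, IHprv. rewrite map_fshift_subst. apply incl_map, HG.
  - rewrite fsubst_inst. apply prv_allE, (IHprv sg r'), HG.
  - apply (prv_exI _ _ _ (tsubst sg t)). rewrite <- fsubst_inst. auto.
  - eapply prv_exE; [apply IHprv1, HG|]. rewrite <- fsubst_fshift.
    apply IHprv2. cbn. apply incl_cons; [left; auto|].
    rewrite map_fshift_subst. apply incl_tl, incl_map, HG.
  - apply prv_all2I, IHprv. rewrite map_fshift2_subst. apply incl_map, HG.
  - rewrite fsubst_inst2. apply prv_all2E, (IHprv sg r'), HG.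
  - apply (prv_ex2I _ _ _ (r' Y)). rewrite <- fsubst_inst2. auto.
  - eapply prv_ex2E; [apply IHprv1, HG|]. rewrite <- fsubst_fshift2.
    apply IHprv2. cbn. apply incl_cons; [left; auto|].
    rewrite map_fshift2_subst. apply incl_tl, incl_map, HG.
  - apply prv_eqI.
  - rewrite fsubst_inst. eapply prv_eqE; [apply (IHprv1 sg r'), HG|].
    rewrite <- fsubst_inst. auto.
Qed.

Lemma prv_subst G p sg r :
  prv T G p -> prv T (map (fsubst sg r) G) (fsubst sg r p).
Proof. intros H. eapply prv_subst_weak; [exact H|apply incl_refl]. Qed.

Lemma prv_weak G G' p : incl G G' -> prv T G p -> prv T G' p.
Proof.
  intros HG H. rewrite <- (fsubst_id p). apply (prv_subst_weak G); auto.
  rewrite (map_ext _ (fun p => p) fsubst_id), map_id. exact HG.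
Qed.

Lemma prv_weak1 G p q : prv T G p -> prv T (q :: G) p.
Proof. apply prv_weak, incl_tl, incl_refl. Qed.

Lemma prv_cut G p q : prv T G p -> prv T (p :: G) q -> prv T G q.
Proof. intros H1 H2. eapply prv_impE; [apply prv_impI, H2|exact H1]. Qed.

Lemma prv_exfalso G p : prv T G ⊥ -> prv T G p.
Proof. intros H. apply prv_raa, prv_weak1, H. Qed.

Lemma prv_not_all G p : prv T G (¬ ∀ p) -> prv T G (∃ ¬ p).
Proof.
  intros H. apply prv_raa. eapply prv_impE; [apply prv_weak1, H|].
  apply prv_allI, prv_raa. cbn.
  eapply prv_impE; [apply prv_hyp; right; left; reflexivity|].
  (* The witness is the eigenvariable itself: instantiating the shifted body at it gives back
     [p]. *)
  apply (prv_exI _ _ _ (tvar 0)). unfold inst.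
  match goal with |- prv _ _ ?q => replace q with (¬ p) end;
    [apply prv_hyp; left; reflexivity|].
  unfold fneg; cbn [fsubst]; f_equal.
  symmetry. rewrite fsubst_comp. etransitivity; [|apply fsubst_id]. f_equal; ext_nat.
Qed.

Lemma prv_not_all2 G p : prv T G (¬ ∀₂ p) -> prv T G (∃₂ ¬ p).
Proof.
  intros H. apply prv_raa. eapply prv_impE; [apply prv_weak1, H|].
  apply prv_all2I, prv_raa. cbn.
  eapply prv_impE; [apply prv_hyp; right; left; reflexivity|].
  apply (prv_ex2I _ _ _ 0). unfold inst2.
  match goal with |- prv _ _ ?q => replace q with (¬ p) end;
    [apply prv_hyp; left; reflexivity|].
  unfold fneg; cbn [fsubst]; f_equal.
  symmetry. rewrite fsubst_comp. etransitivity; [|apply fsubst_id]. f_equal; ext_nat.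
Qed.

Definition consistent (G : list form) : Prop := ~ prv T G ⊥.

Fixpoint gbound (G : list form) : nat :=
  match G with nil => 0 | p :: G => max (fbound p) (gbound G) end.

Lemma gbound_in G p : In p G -> fbound p <= gbound G.
Proof.
  induction G; cbn; intros H; [tauto|].
  destruct H as [->|H]; [lia|]. apply IHG in H. lia.
Qed.

(** A variable beyond all those of the context acts as the Henkin constant. A refutation that uses
    it becomes an application of existential elimination once the variable is renamed to the
    eigenvariable. *)
Lemma consistent_witness G p :
  consistent ((∃ p) :: G) ->
  consistent (inst (tvar (gbound ((∃ p) :: G))) p :: (∃ p) :: G).
Proof.
  set (L := (∃ p) :: G). set (y := gbound L).
  assert (HB : forall q, In q L -> fbound q <= y) by apply gbound_in.
  clearbody y. intros Hc H. apply Hc.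
  eapply prv_exE; [apply prv_hyp; left; reflexivity|]. cbn.
  (* The renaming sends the fresh [y] to the eigenvariable 0 and shifts all others; as [y] does not
     occur in [L], it acts there as [fshift]. *)
  apply (prv_subst _ _
    (fun n => if Nat.eqb n y then tvar 0 else tvar (S n)) (fun X => X)) in H.
  assert (Hp : fbound p <= y) by (apply (HB (∃ p)); left; reflexivity).
  eapply prv_weak, H. clear H. cbn [map]. apply incl_cons.
  - left. unfold inst. rewrite fsubst_comp.
    rewrite <- (fsubst_id p) at 1. apply fsubst_ext; [|reflexivity].
    intros [|n] Hn; cbn.
    + rewrite Nat.eqb_refl. reflexivity.
    + replace (Nat.eqb n y) with false; [reflexivity|].
      symmetry. apply Nat.eqb_neq. lia.
  - apply incl_tl. replace (map _ L) with (map fshift L); [apply incl_refl|].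
    apply map_ext_in. intros q Hq. apply fsubst_ext; [|reflexivity].
    intros n Hn. replace (Nat.eqb n y) with false; [reflexivity|].
    symmetry. apply Nat.eqb_neq. apply HB in Hq. lia.
Qed.

Lemma consistent_witness2 G p :
  consistent ((∃₂ p) :: G) ->
  consistent (inst2 (gbound ((∃₂ p) :: G)) p :: (∃₂ p) :: G).
Proof.
  set (L := (∃₂ p) :: G). set (y := gbound L).
  assert (HB : forall q, In q L -> fbound q <= y) by apply gbound_in.
  clearbody y. intros Hc H. apply Hc.
  eapply prv_ex2E; [apply prv_hyp; left; reflexivity|]. cbn.
  apply (prv_subst _ _ tvar
    (fun n => if Nat.eqb n y then 0 else S n)) in H.
  assert (Hp : fbound p <= y) by (apply (HB (∃₂ p)); left; reflexivity).
  eapply prv_weak, H. clear H. cbn [map]. apply incl_cons.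
  - left. unfold inst2. rewrite fsubst_comp.
    rewrite <- (fsubst_id p) at 1. apply fsubst_ext; [reflexivity|].
    intros [|n] Hn; cbn.
    + rewrite Nat.eqb_refl. reflexivity.
    + replace (Nat.eqb n y) with false; [reflexivity|].
      symmetry. apply Nat.eqb_neq. lia.
  - apply incl_tl. replace (map _ L) with (map fshift2 L); [apply incl_refl|].
    apply map_ext_in. intros q Hq. apply fsubst_ext; [reflexivity|].
    intros n Hn. replace (Nat.eqb n y) with false; [reflexivity|].
    symmetry. apply Nat.eqb_neq. apply HB in Hq. lia.
Qed.

(** Each stage remains a finite list, so the language always has a fresh variable left and no
    constants have to be added. *)
Definition with_witness (p : form) (G : list form) : list form :=
  match p with
  | ∃ q => inst (tvar (gbound (p :: G))) q :: p :: G
  | ∃₂ q => inst2 (gbound (p :: G)) q :: p :: G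
  | _ => p :: G
  end.

Definition extend (p : form) (G : list form) : list form :=
  if excluded_middle_informative (consistent (p :: G))
  then with_witness p G else G.

Lemma extend_consistent p G : consistent G -> consistent (extend p G).
Proof.
  intros HG. unfold extend. destruct (excluded_middle_informative _) as [H|H]; auto.
  destruct p; auto; [apply consistent_witness|apply consistent_witness2]; auto.
Qed.

Lemma incl_with_witness p G : incl (p :: G) (with_witness p G).
Proof. destruct p; cbn; try apply incl_refl; apply incl_tl, incl_refl. Qed.

Lemma extend_incl p G : incl G (extend p G).
Proof.
  unfold extend. destruct (excluded_middle_informative _); [|apply incl_refl].
  intros q Hq. apply incl_with_witness. right. exact Hq.
Qed.

Variable G0 : list form.
Hypothesis G0_consistent : consistent G0.

Fixpoint stage (n : nat) : list form :=
  match n with 0 => G0 | S n => extend (nth_form n) (stage n) end.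

Lemma stage_consistent n : consistent (stage n).
Proof. induction n; cbn; auto using extend_consistent. Qed.

Lemma stage_mono m n : m <= n -> incl (stage m) (stage n).
Proof.
  induction 1; [apply incl_refl|].
  eapply incl_tran; [exact IHle|apply extend_incl].
Qed.

Definition henkin (p : form) : Prop := exists n, prv T (stage n) p.

Lemma henkin0 p : (forall G, prv T G p) -> henkin p.
Proof. exists 0. auto. Qed.

Lemma henkin1 p q : (forall G, prv T G p -> prv T G q) -> henkin p -> henkin q.
Proof. intros H [n Hn]. exists n. auto. Qed.

Lemma henkin2 p q s : (forall G, prv T G p -> prv T G q -> prv T G s) ->
  henkin p -> henkin q -> henkin s.
Proof.
  intros H [n Hn] [m Hm]. exists (max n m).
  apply H; [eapply prv_weak, Hn|eapply prv_weak, Hm]; apply stage_mono; lia.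
Qed.

Lemma henkin_bot : ~ henkin ⊥.
Proof. intros [n Hn]. exact (stage_consistent n Hn). Qed.

Lemma henkin_neg p : henkin (¬ p) -> ~ henkin p.
Proof.
  intros H H'. apply henkin_bot. revert H H'. apply henkin2.
  intros G. apply prv_impE.
Qed.

(** The formula [p] is decided at the stage [fcode p]: it is added if consistent, and otherwise its
    negation is already derivable. *)
Lemma henkin_max p : henkin p \/ henkin (¬ p).
Proof.
  destruct (classic (consistent (p :: stage (fcode p)))) as [H|H].
  - left. exists (S (fcode p)). cbn. rewrite nth_form_fcode. unfold extend.
    destruct (excluded_middle_informative _); [|tauto].
    apply prv_hyp, incl_with_witness. left. reflexivity.
  - right. exists (fcode p). apply NNPP in H. apply prv_impI, H.
Qed.

(** A derivable [p] cannot have been rejected when its turn came, since a rejection would make a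
    later stage, where [p] is derivable, inconsistent. *)
Lemma henkin_with_witness p :
  henkin p -> exists n, incl (with_witness p (stage n)) (stage (S n)).
Proof.
  intros [m Hm]. exists (fcode p). cbn. rewrite nth_form_fcode. unfold extend.
  destruct (excluded_middle_informative _) as [H|H]; [apply incl_refl|].
  exfalso. apply NNPP in H. apply (stage_consistent (max m (fcode p))).
  apply prv_cut with p; eapply prv_weak; try eassumption.
  - apply stage_mono. lia.
  - apply incl_cons; [left; reflexivity|]. apply incl_tl, stage_mono. lia.
Qed.

Lemma henkin_ex p : henkin (∃ p) <-> exists t, henkin (inst t p).
Proof.
  split.
  - intros H. destruct (henkin_with_witness _ H) as [n Hn].
    eexists. exists (S n). apply prv_hyp, Hn. left. reflexivity.
  - intros [t H]. revert H. apply henkin1. intros G. apply prv_exI.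
Qed.

Lemma henkin_ex2 p : henkin (∃₂ p) <-> exists Y, henkin (inst2 Y p).
Proof.
  split.
  - intros H. destruct (henkin_with_witness _ H) as [n Hn].
    eexists. exists (S n). apply prv_hyp, Hn. left. reflexivity.
  - intros [t H]. revert H. apply henkin1. intros G. apply prv_ex2I.
Qed.

(** For the converse, maximality turns failure into the existence of a counterexample, for which the
    construction has supplied a witness. *)
Lemma henkin_all p : henkin (∀ p) <-> forall t, henkin (inst t p).
Proof.
  split.
  - intros H t. revert H. apply henkin1. intros G H. apply prv_allE, H.
  - intros H. destruct (henkin_max (∀ p)) as [|H']; auto. exfalso.
    apply (henkin1 _ (∃ ¬ p)) in H'; [|intros; apply prv_not_all; auto].
    apply henkin_ex in H'. destruct H' as [t Ht]. exact (henkin_neg _ Ht (H t)).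
Qed.

Lemma henkin_all2 p : henkin (∀₂ p) <-> forall Y, henkin (inst2 Y p).
Proof.
  split.
  - intros H t. revert H. apply henkin1. intros G H. apply prv_all2E, H.
  - intros H. destruct (henkin_max (∀₂ p)) as [|H']; auto. exfalso.
    apply (henkin1 _ (∃₂ ¬ p)) in H'; [|intros; apply prv_not_all2; auto].
    apply henkin_ex2 in H'. destruct H' as [t Ht]. exact (henkin_neg _ Ht (H t)).
Qed.

Lemma henkin_imp p q : henkin (p ⇒ q) <-> (henkin p -> henkin q).
Proof.
  split.
  - apply henkin2. intros G. apply prv_impE.
  - intros H. destruct (henkin_max p) as [Hp|Hp].
    + apply H in Hp. revert Hp. apply henkin1. intros. apply prv_impI, prv_weak1. auto.
    + revert Hp. apply henkin1. intros G Hp. apply prv_impI, prv_exfalso.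
      eapply prv_impE; [apply prv_weak1, Hp|apply prv_hyp; left; reflexivity].
Qed.

Lemma henkin_and p q : henkin (p ∧ q) <-> henkin p /\ henkin q.
Proof.
  split.
  - intros H. split; revert H; apply henkin1; intros;
      [eapply prv_andE1|eapply prv_andE2]; eauto.
  - intros [H H']. revert H H'. apply henkin2. intros. apply prv_andI; auto.
Qed.

Lemma henkin_or p q : henkin (p ∨ q) <-> henkin p \/ henkin q.
Proof.
  split.
  - intros H. destruct (henkin_max p) as [Hp|Hp]; [auto|right].
    revert H Hp. apply henkin2. intros G H Hp.
    eapply prv_orE; [exact H| |apply prv_hyp; left; reflexivity].
    apply prv_exfalso. eapply prv_impE; [apply prv_weak1, Hp|].
    apply prv_hyp. left. reflexivity.
  - intros [H|H]; revert H; apply henkin1; intros; [apply prv_orI1|apply prv_orI2]; auto.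
Qed.

Lemma henkin_refl t : henkin (t ≡ t).
Proof. apply henkin0. intros. apply prv_eqI. Qed.

Lemma henkin_rewrite p s t : henkin (s ≡ t) -> henkin (inst s p) -> henkin (inst t p).
Proof. apply henkin2. intros G. apply prv_eqE. Qed.

Lemma inst_tshift t s : tsubst (fun n => match n with 0 => t | S m => tvar m end) (tshift s) = s.
Proof. unfold tshift. rewrite tsubst_comp. apply tsubst_id. Qed.

Lemma henkin_sym s t : henkin (s ≡ t) -> henkin (t ≡ s).
Proof.
  intros H. generalize (henkin_rewrite (tvar 0 ≡ tshift s) s t H).
  cbn. rewrite !inst_tshift. intros E. apply E, henkin_refl.
Qed.

Lemma henkin_trans s t u : henkin (s ≡ t) -> henkin (t ≡ u) -> henkin (s ≡ u).
Proof.
  intros H H'. generalize (henkin_rewrite (tshift s ≡ tvar 0) t u H').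
  cbn. rewrite !inst_tshift. auto.
Qed.

(** * The term model, modulo derivable equality *)

(** A canonical representative of the class of [t]. Elements of the model are the fixed points of
    [rep], so that the equality of the model is identity. *)
Definition rep (t : term) : term := epsilon (inhabits tzero) (fun s => henkin (t ≡ s)).

Lemma rep_spec t : henkin (t ≡ rep t).
Proof.
  apply (epsilon_spec (inhabits tzero) (fun s => henkin (t ≡ s))).
  exists t. apply henkin_refl.
Qed.

Lemma rep_eq s t : rep s = rep t <-> henkin (s ≡ t).
Proof.
  split; intros H.
  - apply henkin_trans with (rep s); [apply rep_spec|].
    rewrite H. apply henkin_sym, rep_spec.
  (* Equal terms define the same predicate by extensionality, hence [epsilon] makes the same choice
     for both. *)
  - unfold rep. f_equal. extensionality u. apply propositional_extensionality.
    split; intros H'; eapply henkin_trans; eauto using henkin_sym.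
Qed.

Lemma rep_idem t : rep (rep t) = rep t.
Proof. apply rep_eq, henkin_sym, rep_spec. Qed.

Definition class_of (t : term) : {t : term | rep t = t} := exist _ (rep t) (rep_idem t).

Lemma class_of_eq s t : class_of s = class_of t <-> henkin (s ≡ t).
Proof.
  rewrite <- rep_eq. split; intros H.
  - exact (f_equal (@proj1_sig _ _) H).
  - apply eq_sig_hprop; [intros; apply proof_irrelevance|exact H].
Qed.

Lemma class_of_proj d : class_of (proj1_sig d) = d.
Proof. apply eq_sig_hprop; [intros; apply proof_irrelevance|exact (proj2_sig d)]. Qed.

(** Since equality is primitive on numbers only, the set sort consists of the set variables
    themselves, without a quotient. *)
Definition term_model : structure := {|
  dom := {t : term | rep t = t};
  sets := nat;
  zero := class_of tzero;
  one := class_of tone;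
  add := fun a b => class_of (tadd (proj1_sig a) (proj1_sig b));
  mul := fun a b => class_of (tmul (proj1_sig a) (proj1_sig b));
  less := fun a b => henkin (proj1_sig a ≺ proj1_sig b);
  elem := fun a X => henkin (proj1_sig a ∈ X) |}.

Lemma teval_term_model sg t :
  teval term_model (fun n => class_of (sg n)) t = class_of (tsubst sg t).
Proof.
  induction t; cbn; auto; rewrite IHt1, IHt2; cbn; apply class_of_eq, henkin_sym.
  - apply henkin_trans with (tadd (rep (tsubst sg t1)) (tsubst sg t2)).
    (* The variable 0 marks the one argument being replaced; [tshift] protects the other parts from
       the instantiation. *)
    + generalize (henkin_rewrite (tadd (tshift (tsubst sg t1)) (tshift (tsubst sg t2))
        ≡ tadd (tvar 0) (tshift (tsubst sg t2))) _ _ (rep_spec (tsubst sg t1))).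
      cbn. rewrite !inst_tshift. intros E. apply E, henkin_refl.
    + generalize (henkin_rewrite (tadd (tshift (rep (tsubst sg t1))) (tshift (tsubst sg t2))
        ≡ tadd (tshift (rep (tsubst sg t1))) (tvar 0)) _ _ (rep_spec (tsubst sg t2))).
      cbn. rewrite !inst_tshift. intros E. apply E, henkin_refl.
  - apply henkin_trans with (tmul (rep (tsubst sg t1)) (tsubst sg t2)).
    + generalize (henkin_rewrite (tmul (tshift (tsubst sg t1)) (tshift (tsubst sg t2))
        ≡ tmul (tvar 0) (tshift (tsubst sg t2))) _ _ (rep_spec (tsubst sg t1))).
      cbn. rewrite !inst_tshift. intros E. apply E, henkin_refl.
    + generalize (henkin_rewrite (tmul (tshift (rep (tsubst sg t1))) (tshift (tsubst sg t2))
        ≡ tmul (tshift (rep (tsubst sg t1))) (tvar 0)) _ _ (rep_spec (tsubst sg t2))).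
      cbn. rewrite !inst_tshift. intros E. apply E, henkin_refl.
Qed.

Lemma henkin_less_rep s t : henkin (rep s ≺ rep t) <-> henkin (s ≺ t).
Proof.
  assert (E : forall s s' t t', henkin (s ≡ s') -> henkin (t ≡ t') ->
    henkin (s ≺ t) -> henkin (s' ≺ t')).
  { intros a a' b b' Ha Hb.
    generalize (henkin_rewrite (tvar 0 ≺ tshift b) _ _ Ha).
    generalize (henkin_rewrite (tshift a' ≺ tvar 0) _ _ Hb).
    cbn. rewrite !inst_tshift. auto. }
  split; apply E; auto using rep_spec, henkin_sym.
Qed.

Lemma henkin_mem_rep s X : henkin (rep s ∈ X) <-> henkin (s ∈ X).
Proof.
  split.
  - apply (henkin_rewrite (tvar 0 ∈ X) _ _ (henkin_sym _ _ (rep_spec s))).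
  - apply (henkin_rewrite (tvar 0 ∈ X) _ _ (rep_spec s)).
Qed.

Lemma inst_up t sg r p : inst t (fsubst (up sg) r p) = fsubst (scons t sg) r p.
Proof. subst_eq. Qed.

Lemma inst2_up Y sg r p : inst2 Y (fsubst sg (up2 r) p) = fsubst sg (scons Y r) p.
Proof.
  unfold inst2. rewrite fsubst_comp. f_equal.
  - extensionality n. apply tsubst_id.
  - ext_nat.
Qed.

Lemma scons_class_of t sg :
  scons (class_of t) (fun n => class_of (sg n)) = fun n => class_of (scons t sg n).
Proof. ext_nat. Qed.

(** Quantifying over all substitutions lets the induction pass binders: a value in the model is the
    class of a term, which is absorbed into [sg]. *)
Lemma truth p : forall sg r,
  sat term_model (fun n => class_of (sg n)) r p <-> henkin (fsubst sg r p).
Proof.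
  induction p; intros sg r;
    cbn [sat fsubst]; rewrite ?teval_term_model.
  - apply class_of_eq.
  - apply henkin_less_rep.
  - apply henkin_mem_rep.
  - split; [tauto|apply henkin_bot].
  - rewrite henkin_imp, IHp1, IHp2. tauto.
  - rewrite henkin_and, IHp1, IHp2. tauto.
  - rewrite henkin_or, IHp1, IHp2. tauto.
  - rewrite henkin_all. split; intros H.
    + intros t. rewrite inst_up, <- IHp, <- scons_class_of. apply H.
    + intros d. rewrite <- (class_of_proj d), scons_class_of, IHp, <- inst_up. apply H.
  - rewrite henkin_ex. split.
    + intros [d H]. exists (proj1_sig d).
      rewrite inst_up, <- IHp, <- scons_class_of, class_of_proj. exact H.
    + intros [t H]. exists (class_of t). rewrite scons_class_of, IHp, <- inst_up. exact H.
  - rewrite henkin_all2. split; intros H Y.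
    + rewrite inst2_up, <- IHp. apply H.
    + rewrite IHp, <- inst2_up. apply H.
  - rewrite henkin_ex2. split; intros [Y H]; exists Y.
    + rewrite inst2_up, <- IHp. exact H.
    + rewrite IHp, <- inst2_up. exact H.
Qed.

Lemma term_model_model : model T term_model.
Proof.
  intros p Hp v r.
  replace v with (fun n => class_of (proj1_sig (v n)))
    by (extensionality n; apply class_of_proj).
  apply truth. apply henkin0. intros G. apply prv_ax. auto.
Qed.

End Completeness.

Theorem completeness T p :
  (forall p, T p -> forall sg r, T (fsubst sg r p)) ->
  (forall M, model T M -> forall v r, sat M v r p) -> provable T p.
Proof.
  intros HT H. apply prv_raa. apply NNPP. intros Hc.
  (* The construction starts from the single formula [¬ p], and its term model is evaluated at the
     identity substitution. *)
  assert (Hm := H _ (term_model_model T HT _ Hc) (fun n => class_of T HT _ (tvar n)) (fun X => X)).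
  apply truth in Hm; auto. rewrite fsubst_id in Hm. revert Hm.
  apply henkin_neg; auto. exists 0. apply prv_hyp. left. reflexivity.
Qed.

(** * Arithmetic in models of RCA_0 *)

Definition ball (t : term) (p : form) : form := ∀ $0 ≺ tshift t ⇒ p.
Definition bex (t : term) (p : form) : form := ∃ $0 ≺ tshift t ∧ p.

Ltac d0 := repeat first [apply D0_ball | apply D0_bex | constructor].

Declare Scope dom_scope.

Section Models.
Variable M : structure.
Hypothesis HM : model RCA0 M.
Variable r0 : nat -> sets M.

Notation D := (dom M).
Notation "0" := (zero M) : dom_scope.
Notation "1" := (one M) : dom_scope.
Notation "a + b" := (add M a b) : dom_scope.
Notation "a * b" := (mul M a b) : dom_scope.
Notation "a < b" := (less M a b) : dom_scope.
Notation "a ∈ A" := (elem M a A) (at level 70) : dom_scope.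
Local Open Scope dom_scope.

Definition env (l : list D) (n : nat) : D := nth n l 0.

(** In [p] the variable 0 is the existential witness and the variable 1 the induction variable;
    parameters start at 2. *)
Lemma Sigma01_ind p v r : Delta00 p ->
  (exists e, sat M (scons e (scons 0 v)) r p) ->
  (forall d, (exists e, sat M (scons e (scons d v)) r p) ->
     exists e, sat M (scons e (scons (d + 1) v)) r p) ->
  forall d, exists e, sat M (scons e (scons d v)) r p.
Proof.
  intros Hp H0 HS.
  assert (H := HM _ (ax_Sigma01_induction (∃ p) (Sigma01_ex p Hp)) v r).
  cbn [sat] in H. apply H; clear H. split.
  - unfold inst. apply sat_subst.
    replace (fun n => _) with (scons 0 v) by (ext_nat). exact H0.
  - intros d H. unfold fsucc. apply sat_subst.
    replace (fun n => teval _ _ _) with (scons (d + 1) v) by (ext_nat). apply HS, H.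
Qed.

(** A vacuous existential quantifier turns the bounded formula into an instance of the scheme. *)
Lemma Delta00_ind p v r : Delta00 p ->
  sat M (scons 0 v) r p ->
  (forall d, sat M (scons d v) r p -> sat M (scons (d + 1) v) r p) ->
  forall d, sat M (scons d v) r p.
Proof.
  intros Hp H0 HS d.
  assert (E : forall d e, sat M (scons e (scons d v)) r (fshift p) <-> sat M (scons d v) r p).
  { intros a e. unfold fshift. rewrite sat_subst. reflexivity. }
  destruct (Sigma01_ind (fshift p) v r (Delta00_subst _ Hp _ _)) with (d := d) as [e He].
  - exists 0. apply E, H0.
  - intros a [e He]. exists 0. apply E, HS. apply E in He. exact He.
  - apply E in He. exact He.
Qed.

Lemma Delta01_comp p q v r : Delta00 p -> Delta00 q ->
  (forall d, (exists e, sat M (scons e (scons d v)) r p) <->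
     (forall e, sat M (scons e (scons d v)) r q)) ->
  exists A, forall d, d ∈ A <-> exists e, sat M (scons e (scons d v)) r p.
Proof.
  intros Hp Hq H.
  assert (C := HM _ (ax_Delta01_comprehension (∃ p) (∀ q) (Sigma01_ex p Hp) (Pi01_all q Hq)) v r).
  destruct C as [A HA].
  - intros d. split; apply H.
  - exists A. intros d. destruct (HA d) as [H1 H2].
    unfold fshift2 in H1, H2. rewrite sat_subst in H1, H2. cbn in H1, H2.
    split; auto.
Qed.

Lemma Delta00_comp p v r : Delta00 p ->
  exists A, forall d, d ∈ A <-> sat M (scons d v) r p.
Proof.
  intros Hp.
  assert (E : forall d e, sat M (scons e (scons d v)) r (fshift p) <-> sat M (scons d v) r p).
  { intros a e. unfold fshift. rewrite sat_subst. reflexivity. }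
  destruct (Delta01_comp (fshift p) (fshift p) v r) as [A HA];
    try apply Delta00_subst, Hp.
  - intros d. setoid_rewrite E. split; [intros [_ H] _|intros H; exists 0; apply H]; auto.
  - exists A. intros d. rewrite HA. setoid_rewrite E.
    split; [intros [_ H]; exact H|exists 0; auto].
Qed.

(** * The ordered semiring of numbers of the model *)

Lemma succ_neq0 a : a + 1 <> 0.
Proof. exact (HM _ ax_succ_neq0 (fun _ => 0) r0 a). Qed.
Lemma succ_inj a b : a + 1 = b + 1 -> a = b.
Proof. exact (HM _ ax_succ_inj (fun _ => 0) r0 a b). Qed.
Lemma add_0_r a : a + 0 = a.
Proof. exact (HM _ ax_add0 (fun _ => 0) r0 a). Qed.
Lemma add_succ_r a b : a + (b + 1) = (a + b) + 1.
Proof. exact (HM _ ax_addS (fun _ => 0) r0 a b). Qed.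
Lemma mul_0_r a : a * 0 = 0.
Proof. exact (HM _ ax_mul0 (fun _ => 0) r0 a). Qed.
Lemma mul_succ_r a b : a * (b + 1) = a * b + a.
Proof. exact (HM _ ax_mulS (fun _ => 0) r0 a b). Qed.
Lemma not_lt_0 a : ~ a < 0.
Proof. exact (HM _ ax_lt0 (fun _ => 0) r0 a). Qed.
Lemma lt_succ a b : a < b + 1 <-> a < b \/ a = b.
Proof. exact (HM _ ax_ltS (fun _ => 0) r0 a b). Qed.

(** Induction is internal to the model, so each property is spelled out as a formula: [$0] is the
    induction variable, and higher indices name the entries of [env]. *)
Lemma add_0_l a : 0 + a = a.
Proof.
  refine (Delta00_ind (feq (0 + $0) ($0)) (env []) r0 ltac:(d0) _ _ a); cbn.
  - apply add_0_r.
  - intros b H. rewrite add_succ_r, H. reflexivity.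
Qed.

Lemma add_succ_l a b : (a + 1) + b = (a + b) + 1.
Proof.
  refine (Delta00_ind (feq (($1 + 1) + $0) (($1 + $0) + 1)) (env [a]) r0 ltac:(d0) _ _ b); cbn.
  - rewrite !add_0_r. reflexivity.
  - intros c H. rewrite !add_succ_r, H. reflexivity.
Qed.

Lemma add_comm a b : a + b = b + a.
Proof.
  refine (Delta00_ind (feq ($1 + $0) ($0 + $1)) (env [a]) r0 ltac:(d0) _ _ b); cbn.
  - rewrite add_0_l. apply add_0_r.
  - intros c H. rewrite add_succ_r, add_succ_l, H. reflexivity.
Qed.

Lemma add_assoc a b c : a + (b + c) = (a + b) + c.
Proof.
  refine (Delta00_ind (feq ($1 + ($2 + $0)) (($1 + $2) + $0)) (env [a; b]) r0 ltac:(d0) _ _ c); cbn.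
  - rewrite !add_0_r. reflexivity.
  - intros d H. rewrite !add_succ_r, H. reflexivity.
Qed.

Lemma mul_0_l a : 0 * a = 0.
Proof.
  refine (Delta00_ind (feq (0 * $0) 0) (env []) r0 ltac:(d0) _ _ a); cbn.
  - apply mul_0_r.
  - intros b H. rewrite mul_succ_r, H. apply add_0_r.
Qed.

Lemma mul_succ_l a b : (a + 1) * b = a * b + b.
Proof.
  refine (Delta00_ind (feq (($1 + 1) * $0) ($1 * $0 + $0)) (env [a]) r0 ltac:(d0) _ _ b); cbn.
  - rewrite !mul_0_r, add_0_r. reflexivity.
  - intros c H. rewrite !mul_succ_r, H, !add_succ_r. f_equal.
    rewrite <- !add_assoc. f_equal. apply add_comm.
Qed.

Lemma mul_comm a b : a * b = b * a.
Proof.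
  refine (Delta00_ind (feq ($1 * $0) ($0 * $1)) (env [a]) r0 ltac:(d0) _ _ b); cbn.
  - rewrite mul_0_l. apply mul_0_r.
  - intros c H. rewrite mul_succ_r, mul_succ_l, H. reflexivity.
Qed.

Lemma mul_add_r a b c : a * (b + c) = a * b + a * c.
Proof.
  refine (Delta00_ind (feq ($1 * ($2 + $0)) ($1 * $2 + $1 * $0)) (env [a; b]) r0 ltac:(d0) _ _ c); cbn.
  - rewrite mul_0_r, !add_0_r. reflexivity.
  - intros d H. rewrite add_succ_r, !mul_succ_r, H, add_assoc. reflexivity.
Qed.

Lemma mul_assoc a b c : a * (b * c) = (a * b) * c.
Proof.
  refine (Delta00_ind (feq ($1 * ($2 * $0)) (($1 * $2) * $0)) (env [a; b]) r0 ltac:(d0) _ _ c); cbn.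
  - rewrite !mul_0_r. reflexivity.
  - intros d H. rewrite !mul_succ_r, mul_add_r, H. reflexivity.
Qed.

Lemma mul_1_l a : 1 * a = a.
Proof. rewrite <- (add_0_l 1), mul_succ_l, mul_0_l. apply add_0_l. Qed.

Lemma dom_semi_ring : semi_ring_theory 0 1 (add M) (mul M) eq.
Proof.
  constructor; intros.
  - apply add_0_l.
  - apply add_comm.
  - apply add_assoc.
  - apply mul_1_l.
  - apply mul_0_l.
  - apply mul_comm.
  - apply mul_assoc.
  - rewrite mul_comm, mul_add_r, !(mul_comm p). reflexivity.
Qed.

Add Ring dom_ring : dom_semi_ring.

Lemma add_cancel_r a b c : a + c = b + c -> a = b.
Proof.
  refine (Delta00_ind (feq ($1 + $0) ($2 + $0) ⇒ feq ($1) ($2)) (env [a; b]) r0 ltac:(d0) _ _ c); cbn.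
  - rewrite !add_0_r. auto.
  - intros d H. rewrite !add_succ_r. intros E. apply H, succ_inj, E.
Qed.

Lemma add_cancel_l a b c : c + a = c + b -> a = b.
Proof. rewrite !(add_comm c). apply add_cancel_r. Qed.

Lemma zero_or_succ a : a = 0 \/ exists b, a = b + 1.
Proof.
  destruct (Sigma01_ind (feq ($1) 0 ∨ feq ($1) ($0 + 1)) (env []) r0 ltac:(d0)) with (d := a)
    as [b Hb]; cbn in *.
  - exists 0. auto.
  - intros d _. exists d. auto.
  - destruct Hb; eauto.
Qed.

(** The axioms give the order by recursion only; expressing it through addition lets [ring] settle
    inequalities with explicit witnesses. *)
Lemma lt_exists a b : a < b <-> exists c, b = a + c + 1.
Proof.
  split.
  - destruct (Sigma01_ind (flt ($2) ($1) ⇒ feq ($1) ($2 + $0 + 1)) (env [a]) r0 ltac:(d0))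
      with (d := b) as [c Hc]; cbn in *; eauto.
    + exists 0. intros H. destruct (not_lt_0 _ H).
    + intros d [c Hc]. destruct (classic (a < d)) as [H|H].
      * exists (c + 1). intros _. rewrite (Hc H) at 1. ring.
      * exists 0. intros H'. apply lt_succ in H' as [H'|H']; [tauto|]. subst. ring.
  - intros [c ->].
    refine (Delta00_ind (flt ($1) ($1 + $0 + 1)) (env [a]) r0 ltac:(d0) _ _ c); cbn.
    + apply lt_succ. right. ring.
    + intros d H. apply lt_succ. left. rewrite add_succ_r. exact H.
Qed.

Lemma lt_irrefl a : ~ a < a.
Proof.
  intros H. apply lt_exists in H as [c Hc]. apply (succ_neq0 c).
  apply (add_cancel_l _ _ a). rewrite add_assoc, <- Hc. ring.
Qed.

Lemma lt_trans a b c : a < b -> b < c -> a < c.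
Proof.
  rewrite !lt_exists. intros [d ->] [e ->]. exists (d + 1 + e). ring.
Qed.

Lemma lt_add_r a c : a < a + c + 1.
Proof. apply lt_exists. eauto. Qed.

(** In the absence of a symbol for the weak order, [a < b + 1] stands for it throughout. *)
Lemma lt_succ_exists a b : a < b + 1 <-> exists c, b = a + c.
Proof.
  rewrite lt_exists. split; intros [c H]; exists c.
  - apply succ_inj, H.
  - rewrite H. reflexivity.
Qed.

Lemma lt_total a b : a < b \/ a = b \/ b < a.
Proof.
  refine (Delta00_ind (flt ($1) ($0) ∨ feq ($1) ($0) ∨ flt ($0) ($1)) (env [a]) r0 ltac:(d0) _ _ b); cbn.
  - destruct (zero_or_succ a) as [->|[c ->]]; auto.
    right; right. apply lt_exists. exists c. ring.
  - intros d [H|[H|H]].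
    + left. apply lt_succ. auto.
    + left. apply lt_succ. auto.
    + apply lt_exists in H as [c ->]. destruct (zero_or_succ c) as [->|[e ->]].
      * right; left. ring.
      * right; right. apply lt_exists. exists e. ring.
Qed.

Lemma add_eq_0 a b : a + b = 0 -> a = 0.
Proof.
  destruct (zero_or_succ a) as [->|[c ->]]; auto.
  rewrite add_succ_l. intros H. destruct (succ_neq0 _ H).
Qed.

(* The value of [tpair]. *)
Definition pair (a b : D) : D := (a + b) * (a + b) + a.
Notation "⟨ a , b ⟩" := (pair a b) (at level 0, a at level 60, b at level 60) : dom_scope.

(** The code lies between the square of the sum of its components and the next square, so it
    determines the sum, and then the first component. *)
Lemma pair_inj a b c d : ⟨a, b⟩ = ⟨c, d⟩ -> a = c /\ b = d.
Proof.
  assert (L : forall a b c d, a + b < c + d -> ⟨a, b⟩ = ⟨c, d⟩ -> False).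
  { clear a b c d. intros a b c d H E. apply lt_exists in H as [e He].
    unfold pair in E. rewrite He in E.
    refine (lt_irrefl ((a + b) * (a + b) + a) _).
    rewrite E at 2. apply lt_exists.
    (* With s = a + b and c + d = s + e + 1, this is the second code minus the first minus 1,
       expanded without subtraction. *)
    exists ((a + b) + b + (a + b + a + b) * e + e * e + e + e + c). ring. }
  intros E. destruct (lt_total (a + b) (c + d)) as [H|[H|H]].
  - destruct (L _ _ _ _ H E).
  - unfold pair in E. rewrite H in E. apply add_cancel_l in E. subst.
    apply add_cancel_l in H. auto.
  - symmetry in E. destruct (L _ _ _ _ H E).
Qed.

Lemma pair_le_l a b : a < ⟨a, b⟩ + 1.
Proof. apply lt_succ_exists. exists ((a + b) * (a + b)). unfold pair. ring. Qed.

Lemma le_mul_succ a b : a < a * (b + 1) + 1.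
Proof. apply lt_succ_exists. exists (a * b). ring. Qed.

Lemma pair_le_r a b : b < ⟨a, b⟩ + 1.
Proof.
  unfold pair. apply lt_succ_exists. destruct (zero_or_succ b) as [->|[c ->]].
  - exists (a * a + a). ring.
  - exists (c * (c + 1) + a * a + a + (1 + 1) * a * (c + 1)). ring.
Qed.

Lemma le_lt_trans a b c : a < b + 1 -> b < c -> a < c.
Proof. rewrite lt_succ. intros [H|<-]; eauto using lt_trans. Qed.

(** ** Codes of finite sets *)

Lemma lt_summand a c k : a + c + 1 < k -> c < k.
Proof.
  apply lt_trans. apply lt_exists. exists a. ring.
Qed.

(* The quotient is bounded to make divisibility a bounded formula. *)
Definition divides (a b : D) : Prop := exists q, q < b + 1 /\ b = a * q.

(** A nonzero divisor makes the quotient at most the dividend, so the bound holds by itself. *)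
Lemma divides_succ a b : divides (a + 1) b <-> exists q, b = (a + 1) * q.
Proof.
  split; [intros (q & _ & H); eauto|].
  intros [q ->]. exists q. split; auto. rewrite mul_comm. apply le_mul_succ.
Qed.

Lemma divides_add a u v :
  divides (a + 1) (u + v) -> divides (a + 1) u -> divides (a + 1) v.
Proof.
  rewrite !divides_succ. intros [s Hs] [t ->].
  destruct (lt_total s t) as [H|H].
  (* Here u would exceed u + v, which is absurd; formally, v is a summand of a sum equal to 0. *)
  - apply lt_exists in H as [c ->]. exists 0. rewrite mul_0_r.
    apply (add_eq_0 _ ((a + 1) * (c + 1))). apply (add_cancel_l _ _ ((a + 1) * s)).
    rewrite add_0_r. etransitivity; [|exact Hs]. ring.
  - assert (E : exists q, s = t + q).
    { destruct H as [->|H]; [exists 0; ring|]. apply lt_exists in H as [c ->].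
      exists (c + 1). ring. }
    destruct E as [q ->]. exists q. apply (add_cancel_l _ _ ((a + 1) * t)).
    rewrite Hs. ring.
Qed.

Lemma divides_mul_r a u v : divides (a + 1) u -> divides (a + 1) (u * v).
Proof. rewrite !divides_succ. intros [q ->]. exists (q * v). ring. Qed.

(* Modulo [m (i + 1) + 1], the product [m * (i + 1)] is -1, so m is invertible. *)
Lemma divides_mul_modulus m i n :
  divides (m * (i + 1) + 1) (n * m) -> divides (m * (i + 1) + 1) n.
Proof.
  intros H. apply (divides_add _ (n * m * (i + 1))).
  - replace (n * m * (i + 1) + n) with ((m * (i + 1) + 1) * n) by ring.
    apply divides_succ. eauto.
  - apply divides_mul_r, H.
Qed.

(** Coprimality of the two moduli, without primes. Their difference is m d, so the modulus of i
    divides n m d, hence n m m because d divides m. Both factors m are invertible modulo that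
    modulus. *)
Lemma code_coprime m n i j d q :
  m = d * q -> (j = i + d \/ i = j + d) ->
  divides (m * (i + 1) + 1) (n * (m * (j + 1) + 1)) <->
  divides (m * (i + 1) + 1) n.
Proof.
  intros Hm Hij. split; [|apply divides_mul_r].
  intros H. apply divides_mul_modulus.
  assert (Hn : divides (m * (i + 1) + 1) (n * (m * (i + 1) + 1))).
  { apply divides_succ. exists n. ring. }
  assert (Hd : divides (m * (i + 1) + 1) (n * m * d)).
  { destruct Hij as [-> | ->].
    - apply (divides_add _ (n * (m * (i + 1) + 1))); auto.
      replace (n * (m * (i + 1) + 1) + n * m * d)
        with (n * (m * (i + d + 1) + 1)) by ring. exact H.
    - apply (divides_add _ (n * (m * (j + 1) + 1))); auto.
      replace (n * (m * (j + 1) + 1) + n * m * d)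
        with (n * (m * (j + d + 1) + 1)) by ring. exact Hn. }
  apply (divides_mul_r _ _ q) in Hd. apply divides_mul_modulus.
  replace (n * m * m) with (n * m * d * q) by (rewrite Hm; ring). exact Hd.
Qed.

(** The multiple is a factorial, built one factor at a time; bounding the quotients keeps the
    induction formula Σ⁰₁. *)
Lemma common_multiple k :
  exists m, 0 < m /\ forall i, i < k -> exists q, q < m + 1 /\ m = (i + 1) * q.
Proof.
  refine (Sigma01_ind (flt 0 ($0) ∧ ball ($1) (bex ($1 + 1) (feq ($2) (($1 + 1) * $0))))
    (env []) r0 ltac:(d0) _ _ k); cbn.
  - exists 1. split; [apply lt_exists; exists 0; ring|]. intros i Hi. destruct (not_lt_0 _ Hi).
  - intros d (m & Hm & H). exists (m * (d + 1)). split.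
    + apply lt_exists in Hm as [e ->]. apply lt_exists. exists (d * (e + 1) + e). ring.
    + intros i Hi.
      assert (E : exists q, m * (d + 1) = (i + 1) * q).
      { apply lt_succ in Hi as [Hi| ->].
        - destruct (H i Hi) as (q & _ & ->). exists (q * (d + 1)). ring.
        - exists m. ring. }
      destruct E as [q Hq]. exists q. split; auto. rewrite Hq, mul_comm. apply le_mul_succ.
Qed.

Definition in_code (p m n : D) : Prop := divides (m * (p + 1) + 1) n.

Definition fin_code (p m n : term) : form :=
  bex (n + 1) (feq (tshift n) ((tshift m * (tshift p + 1) + 1) * $0)).

(** This is the coding behind Gödel's β-function: [n] is the product of the moduli of the members of
    [A] below [k], and differences of indices divide [m], so no other modulus divides [n]. *)
Lemma bounded_set_code A k :
  exists m n, forall p, p < k -> p ∈ A <-> in_code p m n.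
Proof.
  destruct (common_multiple k) as (m & Hm & Hdiv). exists m.
  (* Induction on [j] treats the members below [j]; the premise on [j] sits inside the existential
     to keep the statement Σ⁰₁. *)
  assert (E : forall j, exists n, j < k + 1 ->
    forall i, i < k -> (i < j /\ i ∈ A -> in_code i m n) /\ (in_code i m n -> i < j /\ i ∈ A)).
  { refine (Sigma01_ind (flt ($1) ($2 + 1) ⇒
      ball ($2) (flt ($0) ($2) ∧ fmem ($0) 0 ⇔ fin_code ($0) ($4) ($1)))
      (env [k; m]) (scons A r0) ltac:(d0) _ _); cbn.
    (* The empty product: as [m] is positive, every modulus exceeds 1 and cannot divide it. *)
    - exists 1. intros _ i Hi. split; [intros [H _]; destruct (not_lt_0 _ H)|].
      intros H. exfalso. apply divides_succ in H as [q Hq].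
      apply lt_exists in Hm as [e ->]. destruct (zero_or_succ q) as [->|[q' ->]].
      + rewrite mul_0_r in Hq. apply (succ_neq0 0). rewrite add_0_l. exact Hq.
      + apply (succ_neq0 (e * (i + 1) + i + q' * (((0 + e + 1) * (i + 1) + 1)))).
        apply (add_cancel_r _ _ 1). rewrite add_0_l. symmetry.
        rewrite Hq at 1. ring.
    - intros j [n Hn].
      destruct (classic (j < k)) as [Hj|Hj].
      2: { exists 0. intros H. exfalso. apply Hj. apply lt_exists in H as [c Hc].
           apply lt_exists. exists c. apply succ_inj. rewrite Hc. ring. }
      assert (Hn' := Hn (proj2 (lt_succ _ _) (or_introl Hj))). clear Hn.
      assert (Hlt : forall i, i < j + 1 <-> i < j \/ i = j) by (intros; apply lt_succ).
      destruct (classic (j ∈ A)) as [HA|HA].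
      + exists (n * (m * (j + 1) + 1)). intros _ i Hi.
        change ((i < j + 1 /\ i ∈ A -> in_code i m (n * (m * (j + 1) + 1))) /\
          (in_code i m (n * (m * (j + 1) + 1)) -> i < j + 1 /\ i ∈ A)).
        destruct (classic (i = j)) as [->|Hij].
        * split; [intros _|rewrite Hlt; auto].
          apply divides_succ. exists n. ring.
        * assert (C : in_code i m (n * (m * (j + 1) + 1)) <-> in_code i m n).
          { destruct (lt_total i j) as [H|[H|H]]; [|tauto|];
              apply lt_exists in H as [c Hc];
              (assert (Hck : c < k) by (eapply lt_summand; rewrite <- Hc; assumption));
              destruct (Hdiv c Hck) as (q & _ & Hq);
              apply (code_coprime m n i j (c + 1) q Hq).
            - left. rewrite Hc. ring.
            - right. rewrite Hc. ring. }
          rewrite C, Hlt. destruct (Hn' i Hi) as [H1 H2]. split; [|tauto].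
          intros [[H|H] H']; [apply H1; auto|tauto].
      + exists n. intros _ i Hi. destruct (Hn' i Hi) as [H1 H2]. rewrite Hlt.
        split; [|intros H; destruct (H2 H); auto].
        intros [[H| ->] H']; [apply H1; auto|tauto]. }
  destruct (E k) as [n Hn]. exists n. intros p Hp.
  destruct (Hn (proj2 (lt_succ k k) (or_intror eq_refl)) p Hp). split; tauto.
Qed.

(** ** Functions and primitive recursion *)

(* In p the number variables 2, 1, 0 are the argument, the value and an
   existential witness, so that p defines a partial Sigma01 function; its
   domain is the set variable A. *)
Lemma graph_exists p v r A : Delta00 p ->
  (forall a b c, sat M (scons c (scons b (scons a v))) r p -> a ∈ r A) ->
  (forall a, a ∈ r A -> exists b c, sat M (scons c (scons b (scons a v))) r p) ->
  (forall a b b' c c', sat M (scons c (scons b (scons a v))) r p ->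
     sat M (scons c' (scons b' (scons a v))) r p -> b = b') ->
  exists F, forall t, t ∈ F <->
    exists a b c, t = ⟨a, b⟩ /\ sat M (scons c (scons b (scons a v))) r p.
Proof.
  intros Hp Hdom Htot Hfun.
  (* The renamings [s1] and [s2] move the argument, value and witness of [p] to their places under
     the quantifiers of the two formulas below. *)
  set (s1 := fun n => match n with
    | O => $2 | 1%nat => $0 | 2%nat => $1 | S (S (S n)) => tvar (S (S (S (S n)))) end%l2t).
  set (s2 := fun n => match n with
    | O => $0 | 1%nat => $1 | 2%nat => $3
    | S (S (S n)) => tvar (S (S (S (S (S (S n)))))) end%l2t).
  assert (E1 : forall t c a b, sat M (scons b (scons a (scons c (scons t v)))) r
    (fsubst s1 (fun X => X) p) <-> sat M (scons c (scons b (scons a v))) r p).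
  { intros. rewrite sat_subst.
    match goal with |- sat _ ?e _ _ <-> sat _ ?e' _ _ => replace e with e'; [tauto|] end.
    extensionality n. destruct n as [|[|[|n]]]; reflexivity. }
  assert (E2 : forall t c0 a b b' c, sat M (scons c (scons b' (scons b (scons a (scons c0 (scons t v)))))) r
    (fsubst s2 (fun X => X) p) <-> sat M (scons c (scons b' (scons a v))) r p).
  { intros. rewrite sat_subst.
    match goal with |- sat _ ?e _ _ <-> sat _ ?e' _ _ => replace e with e'; [tauto|] end.
    extensionality n. destruct n as [|[|[|n]]]; reflexivity. }
  (* The Σ⁰₁ form asks for a witness of the value [b]; the Π⁰₁ form says that [a] lies in the domain
     and that every value witnessed below a bound equals [b]. *)
  destruct (Delta01_comp
    (bex ($1 + 1) (bex ($2 + 1) (feq ($3) (tpair ($1) ($0)) ∧ fsubst s1 (fun X => X) p)))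
    (bex ($1 + 1) (bex ($2 + 1) (feq ($3) (tpair ($1) ($0)) ∧ fmem ($1) A ∧
       ball ($2 + 1) (ball ($3 + 1) (fsubst s2 (fun X => X) p ⇒ feq ($1) ($2))))))
    v r) as [F HF].
  - d0. apply Delta00_subst, Hp.
  - d0. apply Delta00_subst, Hp.
  - cbn. setoid_rewrite E1. setoid_rewrite E2. fold pair. intros t. split.
    + intros (c & a & Ha & b & Hb & -> & H) e. exists a. split; auto.
      exists b. split; auto. split; auto. split; [eauto|]. intros b' _ c' _ H'. eauto.
    + intros H. destruct (H 0) as (a & Ha & b & Hb & Ht & HA & _).
      destruct (Htot a HA) as (b' & c' & H').
      (* This bound is large enough to include the true value together with its witness. *)
      destruct (H (b' + c')) as (a1 & Ha1 & b1 & Hb1 & Ht1 & HA1 & H1).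
      assert (E : a1 = a /\ b1 = b) by (apply pair_inj; unfold pair; congruence).
      destruct E; subst a1 b1. exists c', a. split; auto. exists b. split; auto. split; auto.
      replace b with b'; auto. apply (H1 b') with c'; auto; apply lt_succ_exists; eauto.
      exists b'. apply add_comm.
  - exists F. intros t. rewrite HF. cbn. setoid_rewrite E1. split.
    + intros (c & a & Ha & b & Hb & -> & H). exists a, b, c. auto.
    + intros (a & b & c & -> & H). exists c, a. split; [apply pair_le_l|].
      exists b. split; [apply pair_le_r|]. auto.
Qed.

Section Recursion.
Variable F : sets M.
Variable a0 : D.
Hypothesis F_total : forall z u, exists v, ⟨⟨z, u⟩, v⟩ ∈ F.
Hypothesis F_fun : forall z u v v', ⟨⟨z, u⟩, v⟩ ∈ F -> ⟨⟨z, u⟩, v'⟩ ∈ F -> v = v'.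

(* The set coded by (k, m, n) is a finite part of the graph of the function
   defined by recursion, closed under passing to the preceding argument. *)
Definition approx (k m n : D) : Prop :=
  forall p, p < k -> in_code p m n ->
    p = ⟨0, a0⟩ \/
    exists i, i < k /\ exists u, u < k /\ exists v, v < k /\
      p = ⟨i + 1, v⟩ /\ ⟨i, u⟩ < k /\ in_code ⟨i, u⟩ m n /\ ⟨⟨i, u⟩, v⟩ ∈ F.

Definition rec_graph (z u : D) : Prop :=
  exists k m n, approx k m n /\ ⟨z, u⟩ < k /\ in_code ⟨z, u⟩ m n.

(** Induction on the argument [i]: an entry at a successor stems from an entry at its predecessor in
    either code. The values are bounded by the codes, so the induction formula is bounded. *)
Lemma approx_unique k m n k' m' n' :
  approx k m n -> approx k' m' n' ->
  forall i u, u < k -> forall u', u' < k' ->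
    ⟨i, u⟩ < k -> in_code ⟨i, u⟩ m n ->
    ⟨i, u'⟩ < k' -> in_code ⟨i, u'⟩ m' n' -> u = u'.
Proof.
  intros H H'.
  refine (Delta00_ind (ball ($1) (ball ($5)
    (flt (tpair ($2) ($1)) ($3) ⇒ fin_code (tpair ($2) ($1)) ($4) ($5) ⇒
     flt (tpair ($2) ($0)) ($6) ⇒ fin_code (tpair ($2) ($0)) ($7) ($8) ⇒
     feq ($1) ($0)))) (env [k; m; n; k'; m'; n']) r0 ltac:(d0) _ _).
  - intros u Hu u' Hu' H1 H2 H3 H4.
    destruct (H _ H1 H2) as [E|(i & _ & w & _ & v & _ & E & _)];
      apply pair_inj in E as [E E2]; [|symmetry in E; destruct (succ_neq0 _ E)].
    destruct (H' _ H3 H4) as [E'|(i & _ & w & _ & v & _ & E' & _)];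
      apply pair_inj in E' as [E' E2']; [|symmetry in E'; destruct (succ_neq0 _ E')].
    cbn in *. congruence.
  - intros i IH u Hu u' Hu' H1 H2 H3 H4.
    destruct (H _ H1 H2) as [E|(j & _ & w & Hw & v & _ & E & H5 & H6 & H7)];
      apply pair_inj in E as [E E2]; [destruct (succ_neq0 _ E)|].
    destruct (H' _ H3 H4) as [E'|(j' & _ & w' & Hw' & v' & _ & E' & H5' & H6' & H7')];
      apply pair_inj in E' as [E' E2']; [destruct (succ_neq0 _ E')|].
    apply succ_inj in E, E'. cbn in E, E', E2, E2', Hu, Hu' |- *. subst j j' v v'.
    assert (w = w') by (apply (IH w Hw w' Hw'); assumption). subst w'.
    eapply F_fun; eassumption.
Qed.

Lemma rec_graph_fun z u u' : rec_graph z u -> rec_graph z u' -> u = u'.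
Proof.
  intros (k & m & n & H & H1 & H2) (k' & m' & n' & H' & H1' & H2').
  apply (approx_unique k m n k' m' n' H H' z); auto;
    eapply le_lt_trans; try eassumption; apply pair_le_r.
Qed.

Lemma rec_graph_zero : rec_graph 0 a0.
Proof.
  destruct (Delta00_comp (feq ($0) ($1)) (env [⟨0, a0⟩]) r0 ltac:(d0)) as [B HB].
  cbn in HB. destruct (bounded_set_code B (⟨0, a0⟩ + 1)) as (m & n & Hc).
  exists (⟨0, a0⟩ + 1), m, n. split; [|split].
  - intros p Hp H. left. apply HB, Hc; auto.
  - apply lt_succ. auto.
  - apply Hc, HB; auto. apply lt_succ. auto.
Qed.

(** The old finite set with one more pair is formed by comprehension and coded afresh, since a
    larger bound may require a different [m]. *)
Lemma rec_graph_succ z u v : rec_graph z u -> ⟨⟨z, u⟩, v⟩ ∈ F -> rec_graph (z + 1) v.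
Proof.
  intros (k & m & n & H & H1 & H2) HF.
  set (e := ⟨z + 1, v⟩).
  destruct (Delta00_comp (flt ($0) ($1) ∧ fin_code ($0) ($2) ($3) ∨ feq ($0) ($4))
    (env [k; m; n; e]) r0 ltac:(d0)) as [B HB].
  change (forall d, d ∈ B <-> d < k /\ in_code d m n \/ d = e) in HB.
  destruct (bounded_set_code B (e + k + 1)) as (m' & n' & Hc).
  assert (Hk : forall p, p < k -> p < e + k + 1).
  { intros p Hp. eapply lt_trans; [exact Hp|]. apply lt_succ_exists. exists e. ring. }
  assert (He : e < e + k + 1) by apply lt_add_r.
  assert (Hold : forall p, p < k -> in_code p m n -> p < e + k + 1 /\ in_code p m' n').
  { intros p Hp Hin. split; auto. apply Hc; auto. apply HB. auto. }
  exists (e + k + 1), m', n'. split; [|split; auto].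
  - intros p Hp Hin. apply Hc, HB in Hin as [[Hp' Hin]| ->]; auto.
    + destruct (H p Hp' Hin) as [|(i & Hi & w & Hw & x & Hx & E & H5 & H6 & H7)]; auto.
      right. exists i. split; auto. exists w. split; auto. exists x. split; auto.
      split; auto. destruct (Hold _ H5 H6). auto.
    + right. exists z. split; [|exists u; split; [|exists v; split]].
      * apply lt_trans with (z + 1); [apply lt_succ; auto|].
        eapply le_lt_trans, He. apply pair_le_l.
      * apply Hk. eapply le_lt_trans, H1. apply pair_le_r.
      * eapply le_lt_trans, He. apply pair_le_r.
      * split; auto. destruct (Hold _ H1 H2). auto.
  - apply Hc; auto. apply HB. auto.
Qed.

Definition fapprox (k m n a : term) (F : nat) : form :=
  ball k (fin_code ($0) (tshift m) (tshift n) ⇒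
    feq ($0) (tpair 0 (tshift a)) ∨
    bex (tshift k) (bex (tshift (tshift k)) (bex (tshift (tshift (tshift k)))
      (let sh t := tshift (tshift (tshift (tshift t))) in
       feq ($3) (tpair ($2 + 1) ($0)) ∧ flt (tpair ($2) ($1)) (sh k) ∧
       fin_code (tpair ($2) ($1)) (sh m) (sh n) ∧
       fmem (tpair (tpair ($2) ($1)) ($0)) F)))).

Lemma upper_bound3 a b c : exists d, a < d /\ b < d /\ c < d.
Proof.
  exists (a + b + c + 1). repeat split; apply lt_succ_exists;
    [exists (b + c)|exists (a + c)|exists (a + b)]; ring.
Qed.

(** Totality of the Σ⁰₁ graph follows by Σ⁰₁ induction, and a total function with a Σ⁰₁ graph exists
    as a set. *)
Lemma recursion : exists G,
  (forall z, exists u, ⟨z, u⟩ ∈ G) /\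
  (forall z u u', ⟨z, u⟩ ∈ G -> ⟨z, u'⟩ ∈ G -> u = u') /\
  ⟨0, a0⟩ ∈ G /\
  (forall z u v, ⟨z, u⟩ ∈ G -> ⟨⟨z, u⟩, v⟩ ∈ F -> ⟨z + 1, v⟩ ∈ G).
Proof.
  destruct (Delta00_comp (feq ($0) ($0)) (env []) r0 ltac:(d0)) as [A HA].
  cbn in HA.
  set (phi := bex ($0) (bex ($1) (bex ($2)
    (fapprox ($2) ($1) ($0) ($6) 0 ∧ flt (tpair ($5) ($4)) ($2) ∧
     fin_code (tpair ($5) ($4)) ($1) ($0))))).
  assert (Hphi : Delta00 phi) by d0.
  assert (E : forall z u c, sat M (scons c (scons u (scons z (env [a0])))) (scons F (scons A r0)) phi
    <-> exists k, k < c /\ exists m, m < c /\ exists n, n < c /\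
      approx k m n /\ ⟨z, u⟩ < k /\ in_code ⟨z, u⟩ m n) by reflexivity.
  clearbody phi.
  assert (E' : forall z u, rec_graph z u <->
    exists c, sat M (scons c (scons u (scons z (env [a0])))) (scons F (scons A r0)) phi).
  { intros z u. setoid_rewrite E. split.
    - intros (k & m & n & H). destruct (upper_bound3 k m n) as (c & ? & ? & ?).
      exists c, k. split; auto. exists m. split; auto. exists n. auto.
    - intros (c & k & _ & m & _ & n & _ & H). exists k, m, n. exact H. }
  assert (Htot : forall z, exists u, rec_graph z u).
  (* Requiring [u < c] merges the value and the witness into a single unbounded quantifier, as
     induction demands; [sw] swaps the two variables accordingly. *)
  { assert (Hz : forall z, exists c, exists u, u < c /\
      sat M (scons c (scons u (scons z (env [a0])))) (scons F (scons A r0)) phi).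
    2: { intros z. destruct (Hz z) as (c & u & _ & H). exists u. apply E'. eauto. }
    set (sw := fun n => match n with O => $1 | 1%nat => $0 | S (S n) => tvar (S (S n)) end%l2t).
    assert (Es : forall z c u, sat M (scons u (scons c (scons z (env [a0])))) (scons F (scons A r0))
      (fsubst sw (fun X => X) phi) <->
      sat M (scons c (scons u (scons z (env [a0])))) (scons F (scons A r0)) phi).
    { intros. rewrite sat_subst.
      match goal with |- sat _ ?e _ _ <-> sat _ ?e' _ _ => replace e with e'; [tauto|] end.
      extensionality n. destruct n as [|[|n]]; reflexivity. }
    assert (Hex : forall z u, rec_graph z u -> exists c u, u < c /\
      sat M (scons u (scons c (scons z (env [a0])))) (scons F (scons A r0))
        (fsubst sw (fun X => X) phi)).
    { intros z u (k & m & n & H & Hk & H'). destruct (upper_bound3 k m n) as (c & Hc & ? & ?).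
      exists c, u. rewrite Es, E. split.
      2: { exists k. split; auto. exists m. split; auto. exists n. auto. }
      eapply lt_trans, Hc. eapply le_lt_trans, Hk. apply pair_le_r. }
    intros z. setoid_rewrite <- Es.
    refine (Sigma01_ind (bex ($0) (fsubst sw (fun X => X) phi)) (env [a0])
      (scons F (scons A r0)) _ _ _ z).
    - d0. apply Delta00_subst, Hphi.
    - cbn. apply Hex with a0. apply rec_graph_zero.
    - intros d (c & u & _ & H). rewrite Es in H.
      destruct (F_total d u) as [v Hv]. apply Hex with v.
      apply rec_graph_succ with u; auto. apply E'. eauto. }
  destruct (graph_exists phi (env [a0]) (scons F (scons A r0)) 1) as [G HG].
  - exact Hphi.
  - intros. apply HA. reflexivity.
  - intros z _. destruct (Htot z) as [u Hu]. apply E' in Hu as [c Hc]. eauto.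
  - intros. apply rec_graph_fun with a; apply E'; eauto.
  - assert (HG' : forall z u, ⟨z, u⟩ ∈ G <-> rec_graph z u).
    { intros z u. rewrite HG, E'. split.
      - intros (a & b & c & Ep & H). apply pair_inj in Ep as [-> ->]. eauto.
      - intros [c H]. exists z, u, c. auto. }
    exists G. setoid_rewrite HG'. split; [|split; [|split]]; auto.
    + apply rec_graph_fun.
    + apply rec_graph_zero.
    + apply rec_graph_succ.
Qed.
End Recursion.
(** ** The construction of the subspace *)

Section Space.
Variables X U K E : sets M.
Variables x u0 : D.
Hypothesis U_sub : forall n y, ⟨y, n⟩ ∈ U -> y ∈ X.
Hypothesis K_total : forall y m n, y ∈ X -> exists w, ⟨⟨⟨y, m⟩, n⟩, w⟩ ∈ K.
Hypothesis K_fun : forall t w w', ⟨t, w⟩ ∈ K -> ⟨t, w'⟩ ∈ K -> w = w'.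
Hypothesis K_base : forall y m n w,
  ⟨y, m⟩ ∈ U -> ⟨y, n⟩ ∈ U -> ⟨⟨⟨y, m⟩, n⟩, w⟩ ∈ K ->
  ⟨y, w⟩ ∈ U /\ forall z, ⟨z, w⟩ ∈ U -> ⟨z, m⟩ ∈ U /\ ⟨z, n⟩ ∈ U.
Hypothesis E_fun : forall t w w', ⟨t, w⟩ ∈ E -> ⟨t, w'⟩ ∈ E -> w = w'.
Hypothesis E_total : forall y z, y ∈ X -> z ∈ X -> y <> z ->
  exists m n, ⟨⟨y, z⟩, ⟨m, n⟩⟩ ∈ E /\ ⟨y, m⟩ ∈ U /\ ⟨z, n⟩ ∈ U /\
    forall w, ~ (⟨w, m⟩ ∈ U /\ ⟨w, n⟩ ∈ U).
Hypothesis x_in : x ∈ X.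
Hypothesis x_limit : forall n, ⟨x, n⟩ ∈ U -> exists y, ⟨y, n⟩ ∈ U /\ y <> x.
Hypothesis u0_spec : ⟨x, u0⟩ ∈ U.

(* A point z becomes a member of the subspace if it lies in the current
   neighbourhood U_u of x; the next neighbourhood of x then avoids one of z. *)
Definition selected (z u : D) : Prop := z <> x /\ ⟨z, u⟩ ∈ U.

Definition fselected (z u x : term) (U : nat) : form :=
  (¬ feq z x) ∧ fmem (tpair z u) U.

Definition step (z u v : D) : Prop :=
  selected z u /\ (exists p q, ⟨⟨x, z⟩, ⟨p, q⟩⟩ ∈ E /\ ⟨⟨⟨x, u⟩, p⟩, v⟩ ∈ K) \/
  ~ selected z u /\ v = u.

Lemma separation y z p q : y ∈ X -> z ∈ X -> y <> z -> ⟨⟨y, z⟩, ⟨p, q⟩⟩ ∈ E ->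
  ⟨y, p⟩ ∈ U /\ ⟨z, q⟩ ∈ U /\ forall w, ⟨w, p⟩ ∈ U -> ⟨w, q⟩ ∈ U -> False.
Proof.
  intros Hy Hz Hyz H. destruct (E_total y z Hy Hz Hyz) as (m & n & H1 & H2 & H3 & H4).
  destruct (pair_inj _ _ _ _ (E_fun _ _ _ H H1)) as [-> ->].
  split; [|split]; auto. intros w Hm Hn. apply (H4 w). auto.
Qed.

Lemma step_total z u : exists v, step z u v.
Proof.
  destruct (classic (selected z u)) as [[Hz Hu]|H]; [|exists u; right; auto].
  destruct (E_total x z) as (p & q & H & _); eauto.
  destruct (K_total x u p x_in) as [v Hv]. exists v. left. split; [split|]; eauto.
Qed.

Lemma step_fun z u v v' : step z u v -> step z u v' -> v = v'.
Proof.
  intros [[H (p & q & Hp & Hv)]|[H ->]] [[H' (p' & q' & Hp' & Hv')]|[H' ->]];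
    try tauto; auto.
  destruct (pair_inj _ _ _ _ (E_fun _ _ _ Hp Hp')) as [-> ->].
  eapply K_fun; eassumption.
Qed.

(** Being selected is a bounded condition, so only the search for [p] and [q] is unbounded; one
    witness bounds both. The domain is the set of all codes of pairs. *)
Lemma step_graph : exists F, forall z u v, ⟨⟨z, u⟩, v⟩ ∈ F <-> step z u v.
Proof.
  destruct (Delta00_comp (bex ($0 + 1) (bex ($1 + 1) (feq ($2) (tpair ($1) ($0)))))
    (env []) r0 ltac:(d0)) as [A HA].
  change (forall d, d ∈ A <-> exists z, z < d + 1 /\ exists u, u < d + 1 /\ d = ⟨z, u⟩) in HA.
  set (phi := bex ($2 + 1) (bex ($3 + 1) (feq ($4) (tpair ($1) ($0)) ∧
    (fselected ($1) ($0) ($5) 0 ∧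
       bex ($2) (bex ($3) (fmem (tpair (tpair ($7) ($3)) (tpair ($1) ($0))) 1 ∧
         fmem (tpair (tpair (tpair ($7) ($2)) ($1)) ($5)) 2)) ∨
     (¬ fselected ($1) ($0) ($5) 0) ∧ feq ($3) ($0))))%l2).
  assert (Hphi : Delta00 phi) by d0.
  set (r := scons U (scons E (scons K (scons A r0)))).
  assert (S : forall a b c, sat M (scons c (scons b (scons a (env [x])))) r phi <->
    exists z, z < a + 1 /\ exists u, u < a + 1 /\ a = ⟨z, u⟩ /\
      (selected z u /\ (exists p, p < c /\ exists q, q < c /\
         ⟨⟨x, z⟩, ⟨p, q⟩⟩ ∈ E /\ ⟨⟨⟨x, u⟩, p⟩, b⟩ ∈ K) \/
       ~ selected z u /\ b = u)) by reflexivity.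
  clearbody phi.
  assert (S1 : forall a b c, sat M (scons c (scons b (scons a (env [x])))) r phi ->
    exists z u, a = ⟨z, u⟩ /\ step z u b).
  { intros a b c H. apply S in H as (z & _ & u & _ & -> & H).
    exists z, u. split; auto.
    destruct H as [[H (p & _ & q & _ & H')]|H]; [left|right]; eauto. }
  assert (S2 : forall z u v, step z u v ->
    exists c, sat M (scons c (scons v (scons ⟨z, u⟩ (env [x])))) r phi).
  { intros z u v H. setoid_rewrite S.
    destruct H as [[H (p & q & H')]|H].
    - destruct (upper_bound3 p q q) as (c & Hp & Hq & _).
      exists c, z. split; [apply pair_le_l|]. exists u. split; [apply pair_le_r|].
      split; auto. left. split; auto. exists p. split; auto. exists q. auto.
    - exists 0, z. split; [apply pair_le_l|]. exists u. split; [apply pair_le_r|]. auto. }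
  destruct (graph_exists phi (env [x]) r 3 Hphi) as [F HF].
  - intros a b c H. apply S1 in H as (z & u & -> & _). apply HA.
    exists z. split; [apply pair_le_l|]. exists u. split; [apply pair_le_r|]. auto.
  - intros a H. apply HA in H as (z & _ & u & _ & ->).
    destruct (step_total z u) as [v Hv]. exists v. apply S2, Hv.
  - intros a b b' c c' H H'. apply S1 in H as (z & u & -> & H).
    apply S1 in H' as (z' & u' & Ep & H').
    apply pair_inj in Ep as [<- <-]. eapply step_fun; eassumption.
  - exists F. intros z u v. rewrite HF. split.
    + intros (a & b & c & Ep & H). apply pair_inj in Ep as [<- <-].
      apply S1 in H as (z' & u' & Ep & H). apply pair_inj in Ep as [<- <-]. exact H.
    + intros H. apply S2 in H as [c H]. exists ⟨z, u⟩, v, c. auto.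
Qed.

Lemma nested_neighbourhoods : exists G,
  (forall z, exists u, ⟨z, u⟩ ∈ G) /\
  (forall z u u', ⟨z, u⟩ ∈ G -> ⟨z, u'⟩ ∈ G -> u = u') /\
  ⟨0, u0⟩ ∈ G /\
  (forall z u v, ⟨z, u⟩ ∈ G -> step z u v -> ⟨z + 1, v⟩ ∈ G).
Proof.
  destruct step_graph as [F HF]. setoid_rewrite <- HF. apply recursion.
  - intros z u. setoid_rewrite HF. apply step_total.
  - intros z u v v'. rewrite !HF. apply step_fun.
Qed.

Variable G : sets M.
Hypothesis G_total : forall z, exists u, ⟨z, u⟩ ∈ G.
Hypothesis G_fun : forall z u u', ⟨z, u⟩ ∈ G -> ⟨z, u'⟩ ∈ G -> u = u'.
Hypothesis G_zero : ⟨0, u0⟩ ∈ G.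
Hypothesis G_succ : forall z u v, ⟨z, u⟩ ∈ G -> step z u v -> ⟨z + 1, v⟩ ∈ G.

Lemma step_neighbourhood z u v : ⟨x, u⟩ ∈ U -> step z u v ->
  ⟨x, v⟩ ∈ U /\ forall y, ⟨y, v⟩ ∈ U -> ⟨y, u⟩ ∈ U.
Proof.
  intros Hx [[[Hz Hu] (p & q & HE & HK)]|[_ ->]]; auto.
  destruct (separation x z p q) as (Hp & _); eauto.
  destruct (K_base x u p v) as [H1 H2]; auto. split; auto. intros y Hy. apply H2, Hy.
Qed.

(** Induction runs on the existence of a good value, which is Σ⁰₁; uniqueness of values then
    transfers the property to [u]. *)
Lemma G_neighbourhood z u : ⟨z, u⟩ ∈ G -> ⟨x, u⟩ ∈ U.
Proof.
  assert (H : exists w, ⟨z, w⟩ ∈ G /\ ⟨x, w⟩ ∈ U).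
  { refine (Sigma01_ind (fmem (tpair ($1) ($0)) 0 ∧ fmem (tpair ($2) ($0)) 1)
      (env [x]) (scons G (scons U r0)) ltac:(d0) _ _ z).
    - exists u0. split; assumption.
    - intros d (w & H1 & H2). destruct (step_total d w) as [v Hv].
      exists v. split; [exact (G_succ d w v H1 Hv)|].
      exact (proj1 (step_neighbourhood _ _ _ H2 Hv)). }
  destruct H as (w & H1 & H2). intros H. rewrite (G_fun _ _ _ H H1). exact H2.
Qed.

Lemma G_decreasing z t u w y :
  ⟨z, u⟩ ∈ G -> ⟨z + t, w⟩ ∈ G -> ⟨y, w⟩ ∈ U -> ⟨y, u⟩ ∈ U.
Proof.
  intros Hu.
  assert (H : exists w, ⟨z + t, w⟩ ∈ G /\ (⟨y, w⟩ ∈ U -> ⟨y, u⟩ ∈ U)).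
  { refine (Sigma01_ind (fmem (tpair ($2 + $1) ($0)) 0 ∧
        (fmem (tpair ($3) ($0)) 1 ⇒ fmem (tpair ($3) ($4)) 1))
      (env [z; y; u]) (scons G (scons U r0)) ltac:(d0) _ _ t).
    - exists u. split; [cbn; rewrite add_0_r; exact Hu|exact (fun H => H)].
    - intros d (v & H1 & H2). destruct (step_total (z + d) v) as [v' Hv'].
      exists v'. split.
      + cbn. rewrite add_succ_r. exact (G_succ _ v v' H1 Hv').
      + intros H. apply H2.
        exact (proj2 (step_neighbourhood _ _ _ (G_neighbourhood _ v H1) Hv') _ H). }
  destruct H as (w' & H1 & H2). intros H. rewrite (G_fun _ _ _ H H1). exact H2.
Qed.

(** The neighbourhood chosen at [z + 1] is contained in the one with index [p], and all later ones
    are contained in it. *)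
Lemma G_separated z z' u u' p q y :
  z < z' -> ⟨z, u⟩ ∈ G -> selected z u -> ⟨⟨x, z⟩, ⟨p, q⟩⟩ ∈ E ->
  ⟨z', u'⟩ ∈ G -> ⟨y, u'⟩ ∈ U -> ⟨y, p⟩ ∈ U.
Proof.
  intros Hz Hu [Hzx Hzu] HE Hu' Hy. apply lt_exists in Hz as [t ->].
  destruct (separation x z p q) as (Hp & _); eauto.
  destruct (K_total x u p x_in) as [v Hv].
  destruct (K_base x u p v) as [_ H]; eauto using G_neighbourhood.
  apply H. apply (G_decreasing (z + 1) t v u'); auto.
  - apply (G_succ z u); auto. left. split; [split|]; eauto.
  - replace (z + 1 + t) with (z + t + 1) by ring. exact Hu'.
Qed.

(** Some value of [G] and every value of [G] amount to the same, which yields both the Σ⁰₁ and the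
    Π⁰₁ definition. *)
Lemma selected_set : exists Y, forall y, y ∈ Y <-> exists u, ⟨y, u⟩ ∈ G /\ selected y u.
Proof.
  refine (Delta01_comp
    (fmem (tpair ($1) ($0)) 0 ∧ (¬ feq ($1) ($2)) ∧ fmem (tpair ($1) ($0)) 1)
    (fmem (tpair ($1) ($0)) 0 ⇒ (¬ feq ($1) ($2)) ∧ fmem (tpair ($1) ($0)) 1)
    (env [x]) (scons G (scons U r0)) ltac:(d0) ltac:(d0) _).
  intros d. change ((exists u, ⟨d, u⟩ ∈ G /\ selected d u) <->
    forall u, ⟨d, u⟩ ∈ G -> selected d u).
  split.
  - intros (u & Hu & H) u' Hu'. rewrite (G_fun _ _ _ Hu' Hu). exact H.
  - intros H. destruct (G_total d) as [u Hu]. eauto.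
Qed.

Variable Y : sets M.
Hypothesis Y_spec : forall y, y ∈ Y <-> exists u, ⟨y, u⟩ ∈ G /\ selected y u.

Lemma Y_selected y u : y ∈ Y -> ⟨y, u⟩ ∈ G -> selected y u.
Proof.
  intros H Hu. apply Y_spec in H as (u' & Hu' & H).
  rewrite (G_fun _ _ _ Hu Hu'). exact H.
Qed.

Lemma Y_sub y : y ∈ Y -> y ∈ X.
Proof. intros H. apply Y_spec in H as (u & _ & _ & H). eauto. Qed.

Lemma Y_infinite b : ~ forall y, y ∈ Y -> y < b.
Proof.
  intros Hb. destruct (G_total b) as [u Hu].
  assert (Hconst : forall t, ⟨b + t, u⟩ ∈ G).
  { intros t.
    refine (Delta00_ind (fmem (tpair ($1 + $0) ($2)) 0) (env [b; u]) (scons G r0)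
      ltac:(d0) _ _ t).
    - cbn. rewrite add_0_r. exact Hu.
    - intros d H. cbn. rewrite add_succ_r.
      apply (G_succ (b + d) u u H). right. split; auto. intros Hs.
      refine (lt_irrefl b _). apply le_lt_trans with (b + d).
      + apply lt_succ_exists. eauto.
      + apply Hb, Y_spec. exists u. split; [exact H|exact Hs]. }
  destruct (x_limit u (G_neighbourhood _ _ Hu)) as (y & Hyu & Hyx).
  (* If y < b, then [y] was selected and cut off from all later neighbourhoods, including that of
     index [u]. Otherwise [u] is still the index at [y], so [y] is a member of [Y] beyond its
     bound. *)
  destruct (classic (y < b)) as [Hlt|Hge].
  - destruct (G_total y) as [w Hw].
    assert (Hyw : selected y w).
    { split; auto. apply lt_exists in Hlt as [t Ht].
      apply (G_decreasing y (t + 1) w u); auto. rewrite add_succ_r, <- Ht. exact Hu. }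
    destruct (E_total x y) as (p & q & HE & _ & Hyq & Hpq); eauto.
    apply (Hpq y). split; auto. eapply G_separated with (u' := u); eauto.
  - apply Hge, Hb, Y_spec. exists u. split; [|split; auto].
    destruct (lt_total b y) as [H|[<-|H]]; [|auto|tauto].
    apply lt_exists in H as [t ->]. rewrite <- add_succ_r. apply Hconst.
Qed.

Definition isolates (y w : D) : Prop := y ∈ Y /\ exists u p q,
  ⟨y, u⟩ ∈ G /\ ⟨⟨x, y⟩, ⟨p, q⟩⟩ ∈ E /\ ⟨⟨⟨y, u⟩, q⟩, w⟩ ∈ K.

Lemma isolates_total y : y ∈ Y -> exists w, isolates y w.
Proof.
  intros Hy. destruct (G_total y) as [u Hu].
  destruct (Y_selected y u Hy Hu) as [Hyx _].
  assert (HX := Y_sub y Hy).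
  destruct (E_total x y) as (p & q & HE & _); auto.
  destruct (K_total y u q HX) as [w Hw]. exists w. split; eauto 7.
Qed.

Lemma isolates_fun y w w' : isolates y w -> isolates y w' -> w = w'.
Proof.
  intros (_ & u & p & q & Hu & Hp & Hw) (_ & u' & p' & q' & Hu' & Hp' & Hw').
  rewrite (G_fun _ _ _ Hu' Hu) in Hw'.
  destruct (pair_inj _ _ _ _ (E_fun _ _ _ Hp Hp')) as [-> ->].
  eapply K_fun; eassumption.
Qed.

Lemma isolates_spec y w z : isolates y w -> ⟨z, w⟩ ∈ U /\ z ∈ Y <-> z = y.
Proof.
  intros (Hy & u & p & q & Hu & Hp & Hw).
  destruct (Y_selected y u Hy Hu) as [Hyx Hyu].
  destruct (separation x y p q) as (Hxp & Hyq & Hpq); auto using Y_sub.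
  destruct (K_base y u q w) as [Hyw Hsub]; auto.
  split; [|intros ->; auto]. intros [Hz HzY].
  destruct (Hsub z Hz) as [Hzu Hzq].
  destruct (G_total z) as [v Hv]. assert (Hs := Y_selected z v HzY Hv).
  destruct (lt_total z y) as [H|[H|H]]; auto; exfalso.
  (* An earlier [z] was cut off from the neighbourhood with index [u], yet belongs to it. *)
  - destruct Hs as [Hzx Hzv].
    destruct (E_total x z) as (p' & q' & HE & _ & Hzq' & Hpq'); auto using Y_sub.
    + apply (Hpq' z). split; auto.
      eapply G_separated with (u' := u); eauto. split; auto.
  (* A later [z] lies on the side of [x] in the separation of [x] from [y], while [Hzq] puts it on
     the side of [y]. *)
  - apply (Hpq z); auto. destruct Hs as [_ Hzv].
    eapply G_separated with (u' := v) (z := y); eauto. split; auto.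
Qed.

Lemma isolating_function :
  exists d, forall t, t ∈ d <-> exists y w, t = ⟨y, w⟩ /\ isolates y w.
Proof.
  set (phi := (fmem ($2) 0 ∧ bex ($0) (bex ($1) (bex ($2)
    (fmem (tpair ($5) ($2)) 1 ∧ fmem (tpair (tpair ($6) ($5)) (tpair ($1) ($0))) 2 ∧
     fmem (tpair (tpair (tpair ($5) ($2)) ($0)) ($4)) 3))))%l2).
  assert (Hphi : Delta00 phi) by d0.
  set (r := scons Y (scons G (scons E (scons K r0)))).
  assert (S : forall a b c, sat M (scons c (scons b (scons a (env [x])))) r phi <->
    a ∈ Y /\ exists u, u < c /\ exists p, p < c /\ exists q, q < c /\
      ⟨a, u⟩ ∈ G /\ ⟨⟨x, a⟩, ⟨p, q⟩⟩ ∈ E /\ ⟨⟨⟨a, u⟩, q⟩, b⟩ ∈ K) by reflexivity.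
  clearbody phi.
  assert (S' : forall a b, isolates a b <->
    exists c, sat M (scons c (scons b (scons a (env [x])))) r phi).
  { intros a b. setoid_rewrite S. split.
    - intros (Ha & u & p & q & H). destruct (upper_bound3 u p q) as (c & Hu & Hp & Hq).
      exists c. split; auto. exists u. split; auto. exists p. split; auto.
      exists q. split; auto.
    - intros (c & Ha & u & _ & p & _ & q & _ & H). split; auto. exists u, p, q. exact H. }
  destruct (graph_exists phi (env [x]) r 0 Hphi) as [F HF].
  - intros a b c H. apply S in H. apply H.
  - intros a Ha. destruct (isolates_total a Ha) as [w Hw].
    apply S' in Hw as [c Hc]. eauto.
  - intros a b b' c c' H H'. apply (isolates_fun a); apply S'; eauto.
  - exists F. intros t. rewrite HF. setoid_rewrite S'. split.
    + intros (a & b & c & H & H'). eauto.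
    + intros (a & b & H & c & H'). eauto.
Qed.

End Space.

(** * Truth in every model, and provability by completeness *)

Theorem sat_discrete_subspace : forall v, sat M v r0
  (∀₂ ∀₂ ∀₂
     csc_space 2 1 0 ∧ infinite 2 ∧ effectively_Hausdorff 2 1
     ∧ ¬ discrete 2 1
     ⇒ (∃₂ subset 0 3 ∧ infinite 0 ∧ effectively_discrete_subspace 0 2))%l2.
Proof.
  intros v X U K H. cbn in H. fold pair in H.
  destruct H as ((Usub & Ucov & (_ & Ktot & Kfun) & Kbase) & _ & (E & (_ & Etot & Efun) & HE) & Hnd).
  (* Classically, a failure of discreteness is a point each of whose basic neighbourhoods contains
     another point. *)
  assert (Hx : exists x, x ∈ X /\ forall n, ⟨x, n⟩ ∈ U -> exists y, ⟨y, n⟩ ∈ U /\ y <> x).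
  { apply NNPP. intros H. apply Hnd. intros x Hx. apply NNPP. intros Hn.
    apply H. exists x. split; auto. intros n Hxn. apply NNPP. intros Hy.
    apply Hn. exists n. intros y. split; [|intros ->; exact Hxn].
    intros Hyn. apply NNPP. intros Hyx. apply Hy. eauto. }
  destruct Hx as (x & Hx & Hlim). destruct (Ucov x Hx) as [u0 Hu0].
  assert (Hsep : forall y z, y ∈ X -> z ∈ X -> y <> z ->
    exists m n, ⟨⟨y, z⟩, ⟨m, n⟩⟩ ∈ E /\ ⟨y, m⟩ ∈ U /\ ⟨z, n⟩ ∈ U /\
      forall w, ~ (⟨w, m⟩ ∈ U /\ ⟨w, n⟩ ∈ U)).
  { intros y z Hy Hz Hyz. apply (HE y z). auto. }
  assert (Kt : forall y m n, y ∈ X -> exists w, ⟨⟨⟨y, m⟩, n⟩, w⟩ ∈ K).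
  { intros y m n Hy. apply Ktot. exists y, m, n. auto. }
  assert (Kb : forall y m n w,
    ⟨y, m⟩ ∈ U -> ⟨y, n⟩ ∈ U -> ⟨⟨⟨y, m⟩, n⟩, w⟩ ∈ K ->
    ⟨y, w⟩ ∈ U /\ forall z, ⟨z, w⟩ ∈ U -> ⟨z, m⟩ ∈ U /\ ⟨z, n⟩ ∈ U).
  { intros y m n w H1 H2 H3. apply (Kbase y m n w). auto. }
  destruct (nested_neighbourhoods X U K E x u0) as (G & G1 & G2 & G3 & G4); auto.
  destruct (selected_set U x G) as [Y HY]; auto.
  destruct (isolating_function X U K E x) with (G := G) (Y := Y) as [d Hd]; auto.
  assert (Hd' : forall y w, ⟨y, w⟩ ∈ d -> isolates K E x G Y y w).
  { intros y w H. apply Hd in H as (y' & w' & Ep & H).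
    apply pair_inj in Ep as [-> ->]. exact H. }
  exists Y. split; [|split].
  - intros y Hy. eapply Y_sub; eauto.
  - intros [b Hb]. apply (Y_infinite X U K E x u0) with (G := G) (Y := Y) (b := b); auto.
  - exists d. split; [split; [|split]|].
    + intros t Ht. destruct (proj1 (Hd t) Ht) as (y & w & Et & H & _).
      exists y, w. split; [exact H|exact Et].
    + intros y Hy.
      destruct (isolates_total X U K E x) with (G := G) (Y := Y) (y := y) as [w Hw]; auto.
      exists w. apply (Hd ⟨y, w⟩). eauto.
    + intros y w w' H H'.
      apply (isolates_fun K E x) with (G := G) (Y := Y) (y := y); auto; apply Hd'; assumption.
    + intros y w [Hy H] z.
      apply (isolates_spec X U K E x u0) with (G := G) (Y := Y) (y := y); auto.
Qed.

End Models.

Theorem theorem5p3 :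
  provable RCA0
    (∀₂ ∀₂ ∀₂
       (* X = 2, U = 1, k = 0 *)
       csc_space 2 1 0 ∧ infinite 2 ∧ effectively_Hausdorff 2 1
       ∧ ¬ discrete 2 1
       ⇒ (∃₂ (* Y = 0, X = 3, U = 2 *)
            subset 0 3 ∧ infinite 0 ∧ effectively_discrete_subspace 0 2)).
Proof.
  apply completeness.
  - exact RCA0_subst.
  - intros M HM v r. apply sat_discrete_subspace, HM.
Qed.
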